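(* Let $f(z)=z+a_2z^2+a_3z^3+\cdots\in\mathcal{S}^*_G$. Then $$|a_2a_3-a_4|\le\frac16.$$ The inequality is sharp, i.e. there exists $f\in\mathcal{S}^*_G$ for which equality holds.
   Context: Let $\mathbb{D}=\{z\in\mathbb{C}:|z|<1\}$ and let $\mathcal{A}$ be the class of holomorphic functions $f$ on $\mathbb{D}$ with $f(0)=0$, $f'(0)=1$, i.e. $f(z)=z+\sum_{n\ge2}a_nz^n$. For analytic $g,h$ on $\mathbb{D}$, $g\prec h$ ($g$ is subordinate to $h$) means that there is an analytic $\omega:\mathbb{D}\to\mathbb{C}$ with $\omega(0)=0$ and $|\omega(z)|<1$ on $\mathbb{D}$ such that $g(z)=h(\omega(z))$ for all $z\in\mathbb{D}$. Let $\Psi(z)=\dfrac{z}{\ln(1+z)}$ for $z\in\mathbb{D}$ (principal branch of the logarithm, $\Psi(0)=1$); its Taylor coefficients at $0$ are the Gregory coefficients, $\Psi(z)=1+\frac12z-\frac1{12}z^2+\frac1{24}z^3-\cdots$. Define $$\mathcal{S}^*_G=\left\{f\in\mathcal{A}:\ \frac{zf'(z)}{f(z)}\prec\Psi(z)\right\},$$ where $zf'(z)/f(z)$ is understood to take the value $1$ at $z=0$. *)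

(* Defs.v *)
From Stdlib Require Import Reals.
From Coquelicot Require Import Coquelicot.
Open Scope C_scope.

Definition in_disk (z : C) : Prop := (Cmod z < 1)%R.

Definition holomorphic_on_disk (f : C -> C) : Prop :=
  forall z : C, in_disk z -> @ex_derive C_AbsRing C_NormedModule f z.

(* [f z = sum_n (a n) z^n] on the whole disk; such an [a] is the sequence of
   Taylor coefficients of [f] at [0]. *)
Definition power_expansion (f : C -> C) (a : nat -> C) : Prop :=
  forall z : C, in_disk z -> @is_pseries C_AbsRing C_NormedModule a z (f z).

Definition class_A (f : C -> C) : Prop :=
  holomorphic_on_disk f /\ f 0 = 0 /\ C_derive f 0 = 1.

Definition subordinate (g h : C -> C) : Prop :=
  exists w : C -> C,
    holomorphic_on_disk w /\ w 0 = 0 /\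
    (forall z : C, in_disk z -> in_disk (w z)) /\
    (forall z : C, in_disk z -> g z = h (w z)).

(* Principal argument, with values in (-PI, PI] for [w <> 0]. *)
Definition Carg (w : C) : R :=
  if Rle_dec 0 (Im w) then acos (Re w / Cmod w) else (- acos (Re w / Cmod w))%R.

Definition Clog (w : C) : C := (ln (Cmod w), Carg w).

Definition Psi (z : C) : C :=
  if Ceq_dec z 0 then 1 else z / Clog (1 + z).

Definition starlike_quotient (f : C -> C) (z : C) : C :=
  if Ceq_dec z 0 then 1 else z * C_derive f z / f z.

(* Division in [C] is total, so the condition [f z <> 0], under which the
   quotient is meaningful, is stated explicitly. *)
Definition class_SG (f : C -> C) : Prop :=
  class_A f /\
  (forall z : C, in_disk z -> z <> 0 -> f z <> 0) /\
  subordinate (starlike_quotient f) Psi.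

(* Main.v *)
Require Import Defs.
From Stdlib Require Import Reals Lra Lia Psatz List Classical ClassicalEpsilon.
From Coquelicot Require Import Coquelicot.
Open Scope C_scope.

(** Write z f'(z) / f(z) = Psi(w(z)) with w(z) = c1 z + c2 z^2 + c3 z^3 + ...
    Comparing coefficients gives
    a4 - a2 a3 = (c3 - c1 c2 / 3 - c1^3 / 6) / 6. The Schwarz–Pick lemma, applied
    to w(z) / z and then once more to its Möbius quotient, gives
    |c2| <= D and |c3 D + conj(c1) c2^2| <= D^2 - |c2|^2 with D = 1 - |c1|^2,
    from which the triangle inequality yields |c3 - c1 c2 / 3 - c1^3 / 6| <= 1.

    No integration is used. Since 1 / Psi(z) = L(z) = log(1 + z) / z is a power
    series with L' <> 0 on the disk, the equation L(w) f'(z) = f(z) / z makes w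
    analytic in the sense that its difference quotients can be iterated, and for
    such functions the maximum principle follows from the second-order
    expansion at an interior maximum of |phi|^2 + eps |z|^2.

    Equality is attained for w(z) = z^3. The Gregory coefficients are bounded by 1
    (Kaluza's theorem for the log-convex sequence 1 / (n + 1)), so the linear
    differential equation for f(z) / z can be solved by a power series whose
    coefficients are bounded by 1 as well; the equation with the opposite sign
    provides its inverse, so f has no zero besides 0. *)

(** * Iterated difference quotients *)

(** The function [w] is only assumed complex differentiable at each point of the disk, so without
    Cauchy's formula it has at first neither Taylor coefficients nor a maximum principle. The
    expansion of [f], which is given, supplies the missing regularity: [f(z) / z] and [f'] are sums
    of power series, and [w] is a continuous solution of [L(w) = T] with [T] their quotient. Schur's
    algorithm removes the value at 0, divides by z, and divides by [1 - conj(c1) phi]. The notion of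
    regularity must survive all of this; iterated difference quotients do, by algebra alone. The
    upper bound uses [L] rather than [Psi] because the coefficients [(-1)^n / (n + 1)] are explicit:
    those of [(1 + z) L] and [(1 + z) L'] are bounded by telescoping differences, which excludes
    zeros of [L] and [L']. Gregory coefficients enter only in the construction of the extremal
    function. The Möbius quotients degenerate when [|phi(0)| = 1]. The Schwarz-Pick inequality and
    the coefficient bound are therefore proved first for [t phi] with [t < 1]; both sides depend
    continuously on [t]. *)

Definition near (z0 : C) (P : C -> Prop) : Prop :=
  exists d : R, (0 < d)%R /\ forall z, (Cmod (z - z0) < d)%R -> P z.

Definition cont (g : C -> C) (z0 : C) : Prop :=
  forall e : R, (0 < e)%R -> near z0 (fun z => (Cmod (g z - g z0) < e)%R).

Lemma near_and (z0 : C) (P Q : C -> Prop) :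
  near z0 P -> near z0 Q -> near z0 (fun z => P z /\ Q z).
Proof.
intros [d [Hd HP]] [d' [Hd' HQ]].
exists (Rmin d d'); split; [now apply Rmin_glb_lt|].
intros z Hz; split; [apply HP | apply HQ];
  eapply Rlt_le_trans; try exact Hz; [apply Rmin_l | apply Rmin_r].
Qed.

Lemma near_imp (z0 : C) (P Q : C -> Prop) :
  (forall z, P z -> Q z) -> near z0 P -> near z0 Q.
Proof. intros H [d [Hd HP]]; exists d; split; auto. Qed.

Lemma near_all (z0 : C) (P : C -> Prop) : (forall z, P z) -> near z0 P.
Proof. intros H; exists 1%R; split; [lra | auto]. Qed.

Lemma near_center (z0 : C) (P : C -> Prop) : near z0 P -> P z0.
Proof.
intros [d [Hd HP]]; apply HP.
replace (z0 - z0) with (RtoC 0) by ring; now rewrite Cmod_0.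
Qed.

Lemma Cmod_ge_Im (z : C) : (Rabs (Im z) <= Cmod z)%R.
Proof. eapply Rle_trans; [apply Rmax_r | apply Rmax_Cmod]. Qed.

Lemma Cmod_minus_sym (x y : C) : Cmod (x - y) = Cmod (y - x).
Proof. now rewrite <- Cmod_opp; f_equal; ring. Qed.

Lemma Cmod_sub_ge (x y : C) : (Cmod x - Cmod y <= Cmod (x - y))%R.
Proof.
generalize (Cmod_triangle (x - y) y).
replace (x - y + y) with x by ring; lra.
Qed.

Lemma near_disk (z0 : C) : in_disk z0 -> near z0 in_disk.
Proof.
unfold in_disk; intros H; exists (1 - Cmod z0)%R; split; [lra|].
intros z Hz; generalize (Cmod_sub_ge z z0); lra.
Qed.

Lemma near_neq (z0 c : C) : z0 <> c -> near z0 (fun z => z <> c).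
Proof.
intros H; exists (Cmod (z0 - c)); split.
  apply Cmod_gt_0; intros E; apply H.
  now replace z0 with (z0 - c + c) by ring; rewrite E; ring.
intros z Hz ->; rewrite Cmod_minus_sym in Hz; lra.
Qed.

Lemma cont_const (c z0 : C) : cont (fun _ => c) z0.
Proof.
intros e He; apply near_all; intros z.
replace (c - c) with (RtoC 0) by ring; now rewrite Cmod_0.
Qed.

Lemma cont_id (z0 : C) : cont (fun z => z) z0.
Proof. intros e He; exists e; auto. Qed.

Lemma cont_ext (g h : C -> C) (z0 : C) :
  near z0 (fun z => g z = h z) -> cont g z0 -> cont h z0.
Proof.
intros E Hg e He; generalize (near_and _ _ _ E (Hg e He)).
apply near_imp; intros z [E1 E2].
now rewrite <- E1, <- (near_center _ _ E).
Qed.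

Lemma cont_plus (g h : C -> C) (z0 : C) :
  cont g z0 -> cont h z0 -> cont (fun z => g z + h z) z0.
Proof.
intros Hg Hh e He.
assert (He2 : (0 < e / 2)%R) by lra.
generalize (near_and _ _ _ (Hg _ He2) (Hh _ He2)); apply near_imp.
intros z [A B].
replace (g z + h z - (g z0 + h z0)) with ((g z - g z0) + (h z - h z0)) by ring.
eapply Rle_lt_trans; [apply Cmod_triangle | lra].
Qed.

Lemma cont_mult (g h : C -> C) (z0 : C) :
  cont g z0 -> cont h z0 -> cont (fun z => g z * h z) z0.
Proof.
intros Hg Hh e He.
set (A := Cmod (g z0)); set (B := Cmod (h z0)).
assert (HA : (0 <= A)%R) by apply Cmod_ge_0.
assert (HB : (0 <= B)%R) by apply Cmod_ge_0.
set (d := Rmin 1 (e / (2 * (A + B + 1)))).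
assert (Hd : (0 < d)%R).
  apply Rmin_glb_lt; [lra|]; apply Rdiv_lt_0_compat; lra.
assert (Hd1 : (d <= 1)%R) by apply Rmin_l.
assert (Hd2 : (d * (A + B + 1) <= e / 2)%R).
  replace (e / 2)%R with (e / (2 * (A + B + 1)) * (A + B + 1))%R by (field; lra).
  apply Rmult_le_compat_r; [lra | apply Rmin_r].
generalize (near_and _ _ _ (Hg _ Hd) (Hh _ Hd)); apply near_imp.
intros z [Hx Hy].
replace (g z * h z - g z0 * h z0) with
  ((g z - g z0) * (h z - h z0) + (g z0 * (h z - h z0) + (g z - g z0) * h z0))
  by ring.
eapply Rle_lt_trans; [apply Cmod_triangle|].
eapply Rle_lt_trans; [apply Rplus_le_compat_l, Cmod_triangle|].
rewrite !Cmod_mult; fold A B.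
generalize (Cmod_ge_0 (g z - g z0)) (Cmod_ge_0 (h z - h z0)).
set (X := Cmod (g z - g z0)) in *; set (Y := Cmod (h z - h z0)) in *.
intros; nra.
Qed.

Lemma cont_inv (g : C -> C) (z0 : C) :
  cont g z0 -> g z0 <> 0 -> cont (fun z => / g z) z0.
Proof.
intros Hg H0 e He.
assert (HA : (0 < Cmod (g z0))%R) by now apply Cmod_gt_0.
set (A := Cmod (g z0)) in *.
assert (Hd : (0 < Rmin (A / 2) (e * (A * A) / 2))%R).
  apply Rmin_glb_lt; [lra|]; assert (0 < A * A)%R by nra; nra.
generalize (Hg _ Hd); apply near_imp; intros z Hz.
assert (Hz1 := Rlt_le_trans _ _ _ Hz (Rmin_l _ _)).
assert (Hz2 := Rlt_le_trans _ _ _ Hz (Rmin_r _ _)).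
assert (HB : (A / 2 < Cmod (g z))%R).
  generalize (Cmod_sub_ge (g z0) (g z)); rewrite Cmod_minus_sym; fold A; lra.
assert (Hgz : g z <> 0) by (apply Cmod_gt_0; lra).
replace (/ g z - / g z0) with ((g z0 - g z) * / (g z * g z0)) by (field; auto).
rewrite Cmod_mult, Cmod_minus_sym, Cmod_inv by (apply Cmult_neq_0; auto).
rewrite Cmod_mult; fold A.
assert (0 < Cmod (g z) * A)%R by (apply Rmult_lt_0_compat; lra).
apply Rmult_lt_reg_r with (Cmod (g z) * A)%R; auto.
rewrite Rmult_assoc, Rinv_l, Rmult_1_r by lra.
eapply Rlt_le_trans; [exact Hz2|].
assert (A / 2 * A <= Cmod (g z) * A)%R by (apply Rmult_le_compat_r; lra).
nra.
Qed.

Lemma near_comp (g : C -> C) (z0 : C) (P : C -> Prop) :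
  cont g z0 -> near (g z0) P -> near z0 (fun z => P (g z)).
Proof.
intros Hg [d [Hd HP]]; generalize (Hg d Hd); apply near_imp; auto.
Qed.

Lemma cont_comp (g h : C -> C) (z0 : C) :
  cont g z0 -> cont h (g z0) -> cont (fun z => h (g z)) z0.
Proof. intros Hg Hh e He; exact (near_comp g z0 _ Hg (Hh e He)). Qed.

Lemma cont_neq (g : C -> C) (z0 c : C) :
  cont g z0 -> g z0 <> c -> near z0 (fun z => g z <> c).
Proof. intros Hg H; exact (near_comp _ _ _ Hg (near_neq _ _ H)). Qed.

(* [smooth n g z0]: iterated Carathéodory differentiability at [z0]; the
   difference quotient extends to a function that is again [smooth]. *)
Fixpoint smooth (n : nat) (g : C -> C) (z0 : C) : Prop :=
  match n with
  | O => cont g z0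
  | S m => exists g1, smooth m g1 z0 /\
             near z0 (fun z => g z = g z0 + (z - z0) * g1 z)
  end.

Lemma smooth_ext (n : nat) (g h : C -> C) (z0 : C) :
  near z0 (fun z => g z = h z) -> smooth n g z0 -> smooth n h z0.
Proof.
destruct n as [|n]; simpl; intros E; [now apply cont_ext|].
intros [g1 [H1 H2]]; exists g1; split; auto.
generalize (near_and _ _ _ E H2); apply near_imp; intros z [A B].
now rewrite <- A, B, <- (near_center _ _ E).
Qed.

Lemma smooth_S (n : nat) (g : C -> C) (z0 : C) :
  smooth (S n) g z0 -> smooth n g z0.
Proof.
revert g; induction n as [|n IH]; intros g [g1 [H1 H2]].
  simpl in *; apply cont_ext with (fun z => g z0 + (z - z0) * g1 z).
    now apply near_imp with (2 := H2).
  apply cont_plus; [apply cont_const|].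
  apply cont_mult; auto; apply cont_plus; [apply cont_id | apply cont_const].
exists g1; split; auto.
Qed.

Lemma smooth_cont (n : nat) (g : C -> C) (z0 : C) : smooth n g z0 -> cont g z0.
Proof. induction n as [|n IH]; auto; intros H; apply IH, smooth_S, H. Qed.

Lemma smooth_const (n : nat) (c z0 : C) : smooth n (fun _ => c) z0.
Proof.
revert c; induction n as [|n IH]; intros c; [apply cont_const|].
exists (fun _ => 0); split; auto; apply near_all; intros; ring.
Qed.

Lemma smooth_id (n : nat) (z0 : C) : smooth n (fun z => z) z0.
Proof.
destruct n as [|n]; [apply cont_id|].
exists (fun _ => 1); split; [apply smooth_const|].
apply near_all; intros; ring.
Qed.

Lemma smooth_plus (n : nat) (g h : C -> C) (z0 : C) :
  smooth n g z0 -> smooth n h z0 -> smooth n (fun z => g z + h z) z0.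
Proof.
revert g h; induction n as [|n IH]; intros g h; [apply cont_plus|].
intros [g1 [A1 A2]] [h1 [B1 B2]].
exists (fun z => g1 z + h1 z); split; auto.
generalize (near_and _ _ _ A2 B2); apply near_imp.
intros z [-> ->]; ring.
Qed.

Lemma smooth_mult (n : nat) (g h : C -> C) (z0 : C) :
  smooth n g z0 -> smooth n h z0 -> smooth n (fun z => g z * h z) z0.
Proof.
revert g h; induction n as [|n IH]; intros g h; [apply cont_mult|].
intros Hg Hh; assert (Hh' := smooth_S _ _ _ Hh).
destruct Hg as [g1 [A1 A2]], Hh as [h1 [B1 B2]].
exists (fun z => g1 z * h z + g z0 * h1 z); split.
  apply smooth_plus; apply IH; auto; apply smooth_const.
generalize (near_and _ _ _ A2 B2); apply near_imp.
intros z [-> ->]; ring.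
Qed.

(** The quotient of [1 / g] is [- g1 / (g z0 * g)]; its factor [1 / g] is smooth of the lower order
    by induction. *)
Lemma smooth_inv (n : nat) (g : C -> C) (z0 : C) :
  smooth n g z0 -> g z0 <> 0 -> smooth n (fun z => / g z) z0.
Proof.
revert g; induction n as [|n IH]; intros g; [apply cont_inv|].
intros Hg H0; assert (Hg' := smooth_S _ _ _ Hg).
assert (Hc := cont_neq _ _ _ (smooth_cont _ _ _ Hg) H0).
destruct Hg as [g1 [A1 A2]].
exists (fun z => (- / g z0 * g1 z) * / g z); split.
  apply smooth_mult; [apply smooth_mult; auto; apply smooth_const | auto].
generalize (near_and _ _ _ A2 Hc); apply near_imp.
intros z [E Hz].
assert (E' : (z - z0) * g1 z = g z - g z0) by (rewrite E; ring).
replace ((z - z0) * (- / g z0 * g1 z * / g z))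
  with (- ((z - z0) * g1 z) * (/ g z0 * / g z)) by ring.
rewrite E'; field; auto.
Qed.

(** Chain rule in Carathéodory's form: the quotient of the composite is [g1 * (h1 o g)]. Nothing is
    divided by [g z - g z0], which may vanish near [z0]. *)
Lemma smooth_comp (n : nat) (g h : C -> C) (z0 : C) :
  smooth n g z0 -> smooth n h (g z0) -> smooth n (fun z => h (g z)) z0.
Proof.
revert g h; induction n as [|n IH]; intros g h; [apply cont_comp|].
intros Hg Hh; assert (Hg' := smooth_S _ _ _ Hg).
assert (Hc := smooth_cont _ _ _ Hg).
destruct Hg as [g1 [A1 A2]], Hh as [h1 [B1 B2]].
exists (fun z => g1 z * h1 (g z)); split.
  apply smooth_mult; auto.
generalize (near_and _ _ _ A2 (near_comp _ _ _ Hc B2)); apply near_imp.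
intros z [E F]; rewrite F, E; ring.
Qed.

Definition analytic (g : C -> C) (z0 : C) : Prop := forall n, smooth n g z0.

(** The defining equation of a difference quotient says nothing at the centre; continuity is what
    fixes the value there. *)
Lemma cont_unique (g h : C -> C) (z0 : C) :
  cont g z0 -> cont h z0 -> near z0 (fun z => z <> z0 -> g z = h z) ->
  g z0 = h z0.
Proof.
intros Hg Hh E.
destruct (Ceq_dec (g z0) (h z0)) as [|N]; auto; exfalso.
set (e := Cmod (g z0 - h z0)).
assert (He : (0 < e)%R).
  apply Cmod_gt_0; intros F; apply N.
  now replace (g z0) with (g z0 - h z0 + h z0) by ring; rewrite F; ring.
assert (He2 : (0 < e / 2)%R) by lra.
destruct (near_and _ _ _ E (near_and _ _ _ (Hg _ He2) (Hh _ He2)))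
  as [d [Hd HH]].
assert (Hd2 : Cmod (RtoC (d / 2)) = (d / 2)%R).
  rewrite Cmod_R; apply Rabs_right; lra.
destruct (HH (z0 + RtoC (d / 2))) as [H1 [H2 H3]].
  replace (z0 + RtoC (d / 2) - z0) with (RtoC (d / 2)) by ring; lra.
rewrite H1 in H2.
  set (x := h (z0 + RtoC (d / 2))) in *.
  generalize (Cmod_triangle (g z0 - x) (x - h z0)).
  replace (g z0 - x + (x - h z0)) with (g z0 - h z0) by ring.
  fold e; rewrite (Cmod_minus_sym (g z0) x); lra.
intros F.
assert (G : RtoC (d / 2) = 0).
  now replace (RtoC (d / 2)) with (z0 + RtoC (d / 2) - z0) by ring; rewrite F; ring.
rewrite G, Cmod_0 in Hd2; lra.
Qed.

Lemma is_derive_near (g : C -> C) (z0 l : C) :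
  @is_derive C_AbsRing C_NormedModule g z0 l <->
  (forall e : R, (0 < e)%R -> near z0 (fun z =>
     (Cmod (g z - g z0 - (z - z0) * l) <= e * Cmod (z - z0))%R)).
Proof.
split.
- intros [_ H] e He.
  assert (Hl : is_filter_lim (@locally (AbsRing_UniformSpace C_AbsRing) z0) z0)
    by (intros P HP; exact HP).
  destruct (H z0 Hl (mkposreal e He)) as [d Hd].
  exists d; split; [apply d|]; intros z Hz; exact (Hd z Hz).
- intros H; split; [apply (is_linear_scal_l (K := C_AbsRing) (V := C_NormedModule) l)|].
  intros x Hx e.
  assert (E : z0 = x).
    exact (is_filter_lim_locally_unique (V := AbsRing_NormedModule C_AbsRing) z0 x Hx).
  subst x; destruct (H e (cond_pos e)) as [d [Hd HH]].
  exists (mkposreal d Hd); intros z Hz; exact (HH z Hz).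
Qed.

Lemma is_derive_quotient (g g1 : C -> C) (z0 : C) :
  cont g1 z0 -> near z0 (fun z => g z = g z0 + (z - z0) * g1 z) ->
  @is_derive C_AbsRing C_NormedModule g z0 (g1 z0).
Proof.
intros H1 H2; apply is_derive_near; intros e He.
generalize (near_and _ _ _ (H1 e He) H2); apply near_imp; intros z [A B].
replace (g z - g z0 - (z - z0) * g1 z0) with ((z - z0) * (g1 z - g1 z0))
  by (rewrite B; ring).
rewrite Cmod_mult, Rmult_comm.
apply Rmult_le_compat_r; [apply Cmod_ge_0 | lra].
Qed.

Lemma ex_derive_cont (g : C -> C) (z0 : C) :
  @ex_derive C_AbsRing C_NormedModule g z0 -> cont g z0.
Proof.
intros [l H] e He.
set (L := (Cmod l + 1)%R).
assert (HL : (0 < L)%R) by (generalize (Cmod_ge_0 l); unfold L; lra).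
destruct (proj1 (is_derive_near g z0 l) H 1%R Rlt_0_1) as [d [Hd HH]].
exists (Rmin d (e / L)); split.
  apply Rmin_glb_lt; auto; now apply Rdiv_lt_0_compat.
intros z Hz.
assert (A := HH z (Rlt_le_trans _ _ _ Hz (Rmin_l _ _))).
assert (B := Rlt_le_trans _ _ _ Hz (Rmin_r _ _)).
replace (g z - g z0) with ((g z - g z0 - (z - z0) * l) + (z - z0) * l) by ring.
eapply Rle_lt_trans; [apply Cmod_triangle|]; rewrite Cmod_mult.
apply Rle_lt_trans with (Cmod (z - z0) * L)%R; [unfold L; lra|].
apply Rmult_lt_compat_r with (r := L) in B; auto.
unfold Rdiv in B; rewrite Rmult_assoc, Rinv_l in B; lra.
Qed.

(** * Power series on the disk *)

Definition has_sum (u : nat -> C) (l : C) : Prop :=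
  @is_series C_AbsRing C_NormedModule u l.

Lemma pow_n_Cpow (z : C) (n : nat) : @pow_n C_AbsRing z n = z ^ n.
Proof.
induction n as [|n IH]; [reflexivity|].
change (z * @pow_n C_AbsRing z n = z * z ^ n); now rewrite IH.
Qed.

Lemma has_sum_ext (u v : nat -> C) (l : C) :
  (forall n, u n = v n) -> has_sum u l -> has_sum v l.
Proof. intros E; exact (is_series_ext (V := C_NormedModule) u v l E). Qed.

Lemma is_pseries_has_sum (a : nat -> C) (z l : C) :
  @is_pseries C_AbsRing C_NormedModule a z l <-> has_sum (fun n => a n * z ^ n) l.
Proof.
assert (E : forall n, @pow_n C_AbsRing z n * a n = a n * z ^ n).
  intros n; exact (eq_trans (f_equal (fun w => w * a n) (pow_n_Cpow z n)) (Cmult_comm _ _)).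
split; apply has_sum_ext; intros n; [apply E | symmetry; apply E].
Qed.

Lemma has_sum_unique (u : nat -> C) (l l' : C) :
  has_sum u l -> has_sum u l' -> l = l'.
Proof.
exact (filterlim_locally_unique (K := C_AbsRing) (V := C_NormedModule)
         (F := eventually) (sum_n u) l l').
Qed.

Lemma has_sum_plus (u v : nat -> C) (l m : C) :
  has_sum u l -> has_sum v m -> has_sum (fun n => u n + v n) (l + m).
Proof. exact (is_series_plus (V := C_NormedModule) u v l m). Qed.

Lemma has_sum_scal (c : C) (u : nat -> C) (l : C) :
  has_sum u l -> has_sum (fun n => c * u n) (c * l).
Proof. exact (is_series_scal (V := C_NormedModule) c u l). Qed.

Lemma has_sum_shift (u : nat -> C) (l : C) :
  has_sum u l -> has_sum (fun n => u (S n)) (l - u O).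
Proof.
intros H; apply (is_series_incr_1 (V := C_NormedModule)).
change (has_sum u (l - u O + u O)).
now replace (l - u O + u O) with l by ring.
Qed.

Lemma has_sum_exists (u : nat -> C) (v : nat -> R) :
  (forall n, (Cmod (u n) <= v n)%R) -> ex_series v -> exists l, has_sum u l.
Proof. exact (ex_series_le (V := C_CompleteNormedModule) u v). Qed.

Lemma sum_n_Re (u : nat -> C) (n : nat) :
  Re (@sum_n C_AbelianMonoid u n) = sum_n (fun k => Re (u k)) n.
Proof.
induction n as [|n IH]; [now rewrite !sum_O|].
rewrite !sum_Sn, <- IH; reflexivity.
Qed.

Lemma sum_n_Im (u : nat -> C) (n : nat) :
  Im (@sum_n C_AbelianMonoid u n) = sum_n (fun k => Im (u k)) n.
Proof.
induction n as [|n IH]; [now rewrite !sum_O|].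
rewrite !sum_Sn, <- IH; reflexivity.
Qed.

Lemma has_sum_components (u : nat -> C) (l : C) :
  has_sum u l <->
  is_series (fun n => Re (u n)) (Re l) /\ is_series (fun n => Im (u n)) (Im l).
Proof.
unfold has_sum, is_series; split.
- intros H; split; apply filterlim_locally; intros e;
    generalize (proj1 (filterlim_locally _ _) H e); apply filter_imp;
    intros n [A B]; [rewrite <- sum_n_Re | rewrite <- sum_n_Im]; assumption.
- intros [A B]; apply filterlim_locally; intros e.
  generalize (filter_and _ _ (proj1 (filterlim_locally _ _) A e)
                (proj1 (filterlim_locally _ _) B e)); apply filter_imp.
  intros n [H1 H2]; rewrite <- sum_n_Re in H1; rewrite <- sum_n_Im in H2.
  split; assumption.
Qed.

Lemma has_sum_norm_le (u : nat -> C) (v : nat -> R) (l : C) (s : R) :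
  (forall n, (Cmod (u n) <= v n)%R) -> has_sum u l -> is_series v s ->
  (Cmod l <= s)%R.
Proof.
intros Huv Hu Hv.
assert (Hn : is_lim_seq (fun n => Cmod (@sum_n C_AbelianMonoid u n)) (Cmod l)).
  apply (filterlim_comp _ _ _ (@sum_n C_AbelianMonoid u) Cmod _
           (@locally C_UniformSpace l)); [exact Hu|].
  exact (filterlim_norm (V := C_NormedModule) l).
refine (is_lim_seq_le _ _ (Cmod l) s _ Hn Hv).
intros n; induction n as [|n IH]; [now rewrite !sum_O|].
rewrite !sum_Sn.
eapply Rle_trans; [apply Cmod_triangle|].
apply Rplus_le_compat; auto.
Qed.

(** The complex Cauchy product is assembled from four real ones, absolute convergence passing from
    the moduli to the real and imaginary parts. *)
Lemma has_sum_mult (u v : nat -> C) (l m : C) :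
  has_sum u l -> has_sum v m ->
  ex_series (fun n => Cmod (u n)) -> ex_series (fun n => Cmod (v n)) ->
  has_sum (fun n => @sum_n C_AbelianMonoid (fun k => u k * v (n - k)%nat) n) (l * m).
Proof.
intros Hu Hv Au Av.
apply has_sum_components in Hu; apply has_sum_components in Hv.
destruct Hu as [Hu1 Hu2], Hv as [Hv1 Hv2].
assert (HA : forall (w : nat -> C), ex_series (fun n => Cmod (w n)) ->
   ex_series (fun n => Rabs (Re (w n))) /\ ex_series (fun n => Rabs (Im (w n)))).
  intros w Hw; split; apply (ex_series_le (V := R_CompleteNormedModule)) with (2 := Hw);
  intros n; unfold norm; simpl; unfold abs; simpl; rewrite Rabs_Rabsolu.
    apply (Rle_trans _ (Rmax (Rabs (fst (w n))) (Rabs (snd (w n)))));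
      [apply Rmax_l | apply Rmax_Cmod].
    apply (Rle_trans _ (Rmax (Rabs (fst (w n))) (Rabs (snd (w n)))));
      [apply Rmax_r | apply Rmax_Cmod].
destruct (HA u Au) as [U1 U2], (HA v Av) as [V1 V2].
assert (E : forall (x y x' y' : nat -> R) (s : R) n,
  (sum_f_R0 (fun k => x k * y (n - k)%nat) n + s * sum_f_R0 (fun k => x' k * y' (n - k)%nat) n)%R
  = sum_n (fun k => x k * y (n - k)%nat + s * (x' k * y' (n - k)%nat))%R n).
  intros; rewrite <- !sum_n_Reals.
  rewrite <- (sum_n_mult_l (K := R_Ring)); symmetry.
  apply (sum_n_plus (G := R_AbelianMonoid)).
apply has_sum_components; split.
- generalize (is_series_plus _ _ _ _ (is_series_mult _ _ _ _ Hu1 Hv1 U1 V1)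
    (is_series_scal (-1)%R _ _ (is_series_mult _ _ _ _ Hu2 Hv2 U2 V2))).
  intros H; replace (Re (l * m)) with
   (plus (Re l * Re m)%R (scal (-1)%R (Im l * Im m)%R)) by
   (unfold plus, scal; simpl; unfold mult, Re, Im; simpl; ring).
  refine (is_series_ext _ _ _ _ H); intros n.
  refine (eq_trans (E (fun k => Re (u k)) (fun k => Re (v k))
    (fun k => Im (u k)) (fun k => Im (v k)) _ n) _); rewrite sum_n_Re; apply sum_n_ext; intros k.
  unfold Re, Im; simpl; ring.
- generalize (is_series_plus _ _ _ _ (is_series_mult _ _ _ _ Hu1 Hv2 U1 V2)
    (is_series_scal 1%R _ _ (is_series_mult _ _ _ _ Hu2 Hv1 U2 V1))).
  intros H; replace (Im (l * m)) with
   (plus (Re l * Im m)%R (scal 1%R (Im l * Re m)%R)) by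
   (unfold plus, scal; simpl; unfold mult, Re, Im; simpl; ring).
  refine (is_series_ext _ _ _ _ H); intros n.
  refine (eq_trans (E (fun k => Re (u k)) (fun k => Im (v k))
    (fun k => Im (u k)) (fun k => Re (v k)) _ n) _); rewrite sum_n_Im; apply sum_n_ext; intros k.
  unfold Re, Im; simpl; ring.
Qed.

(* The coefficient sequences of power series converging on the unit disk. *)
Definition disk_seq (a : nat -> C) : Prop :=
  forall r : R, (0 <= r < 1)%R -> exists M : R, forall n, (Cmod (a n) * r ^ n <= M)%R.

(** Summation by components with the total operator [Series] gives a value for every [a] and [z]; it
    means something only where the series converges. *)
Definition psum (a : nat -> C) (z : C) : C :=
  (Series (fun n => Re (a n * z ^ n)), Series (fun n => Im (a n * z ^ n))).

Lemma has_sum_psum (a : nat -> C) (z l : C) :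
  has_sum (fun n => a n * z ^ n) l -> psum a z = l.
Proof.
intros H; apply has_sum_components in H; destruct H as [A B]; unfold psum.
rewrite (is_series_unique _ _ A), (is_series_unique _ _ B).
now destruct l.
Qed.

(** A radius [q] strictly between [x] and 1 turns boundedness at [q] into a geometric majorant. It
    is uniform in [y <= x], which serves both absolute convergence and bounds on a whole disk. *)
Lemma disk_seq_geom (a : nat -> C) (x : R) :
  disk_seq a -> (0 <= x < 1)%R ->
  exists q M : R, (x < q < 1)%R /\ (0 <= M)%R /\
    (forall n, (Cmod (a n) * q ^ n <= M)%R) /\
    forall n y, (0 <= y <= x)%R -> (Cmod (a n) * y ^ n <= M * (x / q) ^ n)%R.
Proof.
intros Ha Hx; set (q := ((1 + x) / 2)%R).
assert (Hq : (x < q < 1)%R) by (unfold q; lra).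
destruct (Ha q) as [M HM]; [lra|].
exists q, M; split; auto; split.
  generalize (HM O) (Cmod_ge_0 (a O)); simpl; lra.
split; auto; intros n y Hy.
apply Rle_trans with (Cmod (a n) * x ^ n)%R.
  apply Rmult_le_compat_l; [apply Cmod_ge_0 | now apply pow_incr].
replace (x ^ n)%R with (q ^ n * (x / q) ^ n)%R.
  rewrite <- Rmult_assoc; apply Rmult_le_compat_r; auto.
  apply pow_le, Rdiv_le_0_compat; lra.
rewrite <- Rpow_mult_distr; f_equal; field; lra.
Qed.

Lemma is_series_geom_scal (M t : R) :
  (0 <= t < 1)%R -> is_series (fun n => M * t ^ n)%R (M * / (1 - t))%R.
Proof.
intros Ht; apply (is_series_scal (V := R_NormedModule) M (fun n => t ^ n)%R).
apply is_series_geom.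
rewrite Rabs_right; lra.
Qed.

Lemma ratio_lt_1 (x q : R) : (0 <= x < q)%R -> (0 <= x / q < 1)%R.
Proof.
intros H; split; [apply Rdiv_le_0_compat; lra|].
apply Rmult_lt_reg_r with q; [lra|]; unfold Rdiv.
rewrite Rmult_assoc, Rinv_l; lra.
Qed.

Lemma disk_seq_abs (a : nat -> C) (z : C) :
  disk_seq a -> in_disk z -> ex_series (fun n => Cmod (a n * z ^ n)).
Proof.
intros Ha Hz.
destruct (disk_seq_geom a (Cmod z) Ha) as [q [M [Hq [HM [_ H]]]]].
  split; [apply Cmod_ge_0 | exact Hz].
apply (ex_series_le (V := R_CompleteNormedModule)) with (fun n => M * (Cmod z / q) ^ n)%R.
  intros n; unfold norm; simpl; unfold abs; simpl.
  rewrite Rabs_right by (apply Rle_ge, Cmod_ge_0).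
  rewrite Cmod_mult, Cmod_pow; apply H; split; [apply Cmod_ge_0 | lra].
eexists; apply is_series_geom_scal, ratio_lt_1.
split; [apply Cmod_ge_0 | lra].
Qed.

Lemma psum_correct (a : nat -> C) (z : C) :
  disk_seq a -> in_disk z -> has_sum (fun n => a n * z ^ n) (psum a z).
Proof.
intros Ha Hz.
destruct (has_sum_exists (fun n => a n * z ^ n) _ (fun n => Rle_refl _)
            (disk_seq_abs a z Ha Hz)) as [l Hl].
now rewrite (has_sum_psum _ _ _ Hl).
Qed.

Lemma disk_seq_of_expansion (f : C -> C) (a : nat -> C) :
  power_expansion f a -> disk_seq a.
Proof.
intros H r Hr.
assert (Hd : in_disk (RtoC r)).
  unfold in_disk; rewrite Cmod_R, Rabs_right; lra.
assert (Hs := proj1 (is_pseries_has_sum _ _ _) (H _ Hd)).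
apply has_sum_components in Hs; destruct Hs as [H1 H2].
assert (HB : forall u : nat -> R, ex_series u -> exists M, forall n, (Rabs (u n) <= M)%R).
  intros u Hu; assert (Hl := ex_series_lim_0 _ Hu).
  destruct (proj2 (is_lim_seq_spec _ _) Hl (mkposreal 1 Rlt_0_1)) as [N HN].
  simpl in HN.
  assert (HF : exists M, forall n, (n < N)%nat -> (Rabs (u n) <= M)%R).
    clear HN; induction N as [|N [M HM]]; [exists 0%R; intros; lia|].
    exists (Rmax M (Rabs (u N))); intros n Hn.
    destruct (Nat.eq_dec n N) as [->|]; [apply Rmax_r|].
    eapply Rle_trans; [apply HM; lia | apply Rmax_l].
  destruct HF as [M HM]; exists (Rmax M 1); intros n.
  destruct (Nat.lt_ge_cases n N) as [K|K].
    eapply Rle_trans; [now apply HM | apply Rmax_l].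
  generalize (HN n K); rewrite Rminus_0_r; intros K'.
  eapply Rle_trans; [left; exact K' | apply Rmax_r].
destruct (HB _ (ex_intro _ _ H1)) as [M1 HM1], (HB _ (ex_intro _ _ H2)) as [M2 HM2].
exists (sqrt 2 * Rmax M1 M2)%R; intros n.
replace (Cmod (a n) * r ^ n)%R with (Cmod (a n * RtoC r ^ n)).
  eapply Rle_trans; [apply Cmod_2Rmax|].
  apply Rmult_le_compat_l; [apply sqrt_pos|].
  apply Rmax_lub; eapply Rle_trans;
    [apply HM1 | apply Rmax_l | apply HM2 | apply Rmax_r].
now rewrite Cmod_mult, Cmod_pow, Cmod_R, (Rabs_right r) by lra.
Qed.

Lemma expansion_psum (f : C -> C) (a : nat -> C) (z : C) :
  power_expansion f a -> in_disk z -> psum a z = f z.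
Proof. intros H Hz; apply has_sum_psum, is_pseries_has_sum, H, Hz. Qed.

Lemma psum_expansion (a : nat -> C) : disk_seq a -> power_expansion (psum a) a.
Proof. intros Ha z Hz; now apply is_pseries_has_sum, psum_correct. Qed.

Lemma disk_seq_bounded (a : nat -> C) (M : R) :
  (forall n, (Cmod (a n) <= M)%R) -> disk_seq a.
Proof.
intros H r Hr; exists M; intros n.
assert (r ^ n <= 1)%R.
  replace 1%R with (1 ^ n)%R by apply pow1; apply pow_incr; lra.
assert (0 <= r ^ n)%R by (apply pow_le; lra).
generalize (H n) (Cmod_ge_0 (a n)); nra.
Qed.

Lemma disk_seq_large (a : nat -> C) (r0 : R) :
  (r0 < 1)%R ->
  (forall r, (0 <= r < 1)%R -> (r0 < r)%R ->
     exists M, forall n, (Cmod (a n) * r ^ n <= M)%R) -> disk_seq a.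
Proof.
intros H0 H r Hr.
destruct (H ((1 + Rmax r r0) / 2)%R) as [M HM].
- generalize (Rmax_l r r0) (Rmax_lub_lt r r0 1); lra.
- generalize (Rmax_r r r0) (Rmax_lub_lt r r0 1); lra.
- exists M; intros n; eapply Rle_trans; [|apply (HM n)].
  apply Rmult_le_compat_l; [apply Cmod_ge_0|]; apply pow_incr.
  generalize (Rmax_l r r0) (Rmax_lub_lt r r0 1); lra.
Qed.

Lemma disk_seq_shift (a : nat -> C) : disk_seq a -> disk_seq (fun n => a (S n)).
Proof.
intros Ha; apply (disk_seq_large _ 0); [lra|]; intros r Hr Hr0.
destruct (Ha r Hr) as [M HM]; exists (M / r)%R; intros n.
apply Rmult_le_reg_r with r; auto.
unfold Rdiv; rewrite (Rmult_assoc M), Rinv_l, Rmult_1_r by lra.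
generalize (HM (S n)); simpl; lra.
Qed.

Lemma disk_seq_mul_nat (a : nat -> C) :
  disk_seq a -> disk_seq (fun n => RtoC (INR n) * a n).
Proof.
intros Ha r Hr.
destruct (disk_seq_geom a r Ha Hr) as [q [M [Hq [HM [_ H]]]]].
set (t := (r / q)%R).
assert (Ht : (0 <= t < 1)%R) by (apply ratio_lt_1; lra).
exists (M * / (1 - t))%R; intros n.
rewrite Cmod_mult, Cmod_R, (Rabs_right (INR n)) by (apply Rle_ge, pos_INR).
assert (K := H n r (conj (proj1 Hr) (Rle_refl r))); fold t in K.
(* From [n t^n <= 1 + t + ... + t^(n-1) = (1 - t^n) / (1 - t)]. *)
assert (Hn : (INR n * t ^ n * (1 - t) <= 1)%R).
  assert (J : (INR n * t ^ n * (1 - t) <= 1 - t ^ n)%R).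
    clear K; induction n as [|n IH]; [simpl; lra|].
    rewrite S_INR; simpl.
    assert (0 <= t ^ n)%R by (apply pow_le; lra).
    assert (t ^ n <= 1)%R.
      replace 1%R with (1 ^ n)%R by apply pow1; apply pow_incr; lra.
    assert (0 <= (1 - t) * (1 - t * t ^ n))%R by (apply Rmult_le_pos; nra).
    apply Rmult_le_compat_l with (r := t) in IH; lra.
  assert (0 <= t ^ n)%R by (apply pow_le; lra); lra.
apply Rmult_le_reg_r with (1 - t)%R; [lra|].
rewrite (Rmult_assoc M), Rinv_l, Rmult_1_r by lra.
apply Rmult_le_compat_l with (r := INR n) in K; [|apply pos_INR].
apply Rmult_le_compat_l with (r := M) in Hn; auto.
apply Rle_trans with (INR n * (M * t ^ n) * (1 - t))%R; [|lra].
apply Rmult_le_compat_r; lra.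
Qed.

Definition dseq (a : nat -> C) (n : nat) : C := RtoC (INR (S n)) * a (S n).

Lemma disk_seq_dseq (a : nat -> C) : disk_seq a -> disk_seq (dseq a).
Proof. intros H; exact (disk_seq_shift _ (disk_seq_mul_nat _ H)). Qed.

(* Coefficients of the quotient of [psum a z - psum a z0] by [z - z0],
   as produced by Horner's scheme. *)
Definition qseq (a : nat -> C) (z0 : C) (k : nat) : C :=
  psum (fun j => a (S k + j)%nat) z0.

Lemma disk_seq_add (a : nat -> C) (k : nat) :
  disk_seq a -> disk_seq (fun n => a (k + n)%nat).
Proof.
revert a; induction k as [|k IH]; intros a Ha; auto.
exact (IH _ (disk_seq_shift _ Ha)).
Qed.

(** For [|z0| < r < 1], the bound [|a n| <= M / r^n] gives the k-th coefficient the majorant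
    [M / r^(k+1)] times a geometric series of ratio [|z0| / r]. Smaller radii follow from larger
    ones. *)
Lemma disk_seq_qseq (a : nat -> C) (z0 : C) :
  disk_seq a -> in_disk z0 -> disk_seq (qseq a z0).
Proof.
intros Ha Hz; apply (disk_seq_large _ (Cmod z0)); auto; intros r Hr Hr0.
destruct (Ha r Hr) as [M HM].
assert (H0 := Cmod_ge_0 z0).
set (t := (Cmod z0 / r)%R).
assert (Ht : (0 <= t < 1)%R) by (apply ratio_lt_1; lra).
exists (M / r * / (1 - t))%R; intros k.
assert (Hk : (0 < r ^ k)%R) by (apply pow_lt; lra).
apply Rle_trans with (M / r ^ S k * / (1 - t) * r ^ k)%R.
  apply Rmult_le_compat_r; [lra|]; unfold qseq.
  refine (has_sum_norm_le _ _ _ _ _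
    (psum_correct _ _ (disk_seq_add a (S k) Ha) Hz)
    (is_series_geom_scal (M / r ^ S k) t Ht)).
  intros j; rewrite Cmod_mult, Cmod_pow.
  assert (Hkj : (0 < r ^ (S k + j))%R) by (apply pow_lt; lra).
  replace (M / r ^ S k * t ^ j)%R with (M / r ^ (S k + j) * Cmod z0 ^ j)%R.
    apply Rmult_le_compat_r; [now apply pow_le|].
    apply Rmult_le_reg_r with (r ^ (S k + j))%R; auto; unfold Rdiv.
    rewrite (Rmult_assoc M), Rinv_l, Rmult_1_r by lra; apply HM.
  unfold t, Rdiv; rewrite Rpow_mult_distr, pow_inv, pow_add; field.
  split; apply pow_nonzero; lra.
right; simpl; field; repeat split; try lra.
Qed.

Lemma qseq_rec (a : nat -> C) (z0 : C) (k : nat) :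
  disk_seq a -> in_disk z0 -> qseq a z0 k = a (S k) + z0 * qseq a z0 (S k).
Proof.
intros Ha Hz.
assert (H1 := psum_correct _ _ (disk_seq_add a (S k) Ha) Hz).
assert (H2 := psum_correct _ _ (disk_seq_add a (S (S k)) Ha) Hz).
apply (has_sum_scal z0) in H2; apply has_sum_shift in H1.
fold (qseq a z0 k) in H1; fold (qseq a z0 (S k)) in H2.
replace (S k + 0)%nat with (S k) in H1 by lia; simpl (z0 ^ 0) in H1.
assert (E : qseq a z0 k - a (S k) * 1 = z0 * qseq a z0 (S k)).
  apply (has_sum_unique _ _ _ H1); refine (has_sum_ext _ _ _ _ H2).
  intros n; replace (S k + S n)%nat with (S (S k) + n)%nat by lia; simpl; ring.
rewrite <- E; ring.
Qed.

Lemma psum_split (a : nat -> C) (z0 : C) :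
  disk_seq a -> in_disk z0 -> psum a z0 = a O + z0 * psum (fun n => a (S n)) z0.
Proof.
intros Ha Hz; change (psum a z0 = a O + z0 * qseq a z0 0).
assert (H1 := psum_correct _ _ Ha Hz).
assert (H2 := psum_correct _ _ (disk_seq_add a 1 Ha) Hz).
apply (has_sum_scal z0) in H2; apply has_sum_shift in H1.
fold (qseq a z0 0) in H2; simpl (z0 ^ 0) in H1.
assert (E : psum a z0 - a O * 1 = z0 * qseq a z0 0).
  apply (has_sum_unique _ _ _ H1); refine (has_sum_ext _ _ _ _ H2).
  intros n; simpl; ring.
rewrite <- E; ring.
Qed.

(** Multiplying the quotient series by [z - z0] leaves the coefficients [q_k - z0 q_(k+1)], and
    these are [a_(k+1)] by the Horner recursion. *)
Lemma psum_quotient (a : nat -> C) (z0 z : C) :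
  disk_seq a -> in_disk z0 -> in_disk z ->
  psum a z = psum a z0 + (z - z0) * psum (qseq a z0) z.
Proof.
intros Ha Hz0 Hz.
assert (H1 := has_sum_shift _ _ (psum_correct _ _ Ha Hz)).
assert (Hq := disk_seq_qseq a z0 Ha Hz0).
assert (H2 := psum_correct _ _ Hq Hz).
assert (H3 := has_sum_shift _ _ H2).
assert (E := has_sum_plus _ _ _ _ (has_sum_scal z _ _ H2) (has_sum_scal (- z0) _ _ H3)).
apply (has_sum_ext _ (fun n => a (S n) * z ^ S n)) in E;
  [|intros n; rewrite (qseq_rec a z0 n Ha Hz0); simpl; ring].
assert (F := has_sum_unique _ _ _ H1 E).
assert (H0 : psum a z0 = a O + z0 * qseq a z0 0) by exact (psum_split a z0 Ha Hz0).
simpl in F; rewrite H0.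
replace (psum a z) with (psum a z - a O * 1 + a O) by ring.
rewrite F; ring.
Qed.

(** By the recursion, [(n + 1) a_(n+1) z0^n = q_n z0^n + n q_n z0^n - (n + 1) q_(n+1) z0^(n+1)]. The
    last two terms cancel after summation, because the shifted series only loses a zero term. *)
Lemma psum_qseq_diag (a : nat -> C) (z0 : C) :
  disk_seq a -> in_disk z0 -> psum (qseq a z0) z0 = psum (dseq a) z0.
Proof.
intros Ha Hz.
assert (Hq := disk_seq_qseq a z0 Ha Hz).
assert (H1 := psum_correct _ _ Hq Hz).
assert (H2 := psum_correct _ _ (disk_seq_mul_nat _ Hq) Hz).
assert (H3 := has_sum_shift _ _ H2).
assert (E := has_sum_plus _ _ _ _ (has_sum_plus _ _ _ _ H1 H2) (has_sum_scal (-1) _ _ H3)).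
symmetry; apply has_sum_psum.
replace (psum (qseq a z0) z0) with
  (psum (qseq a z0) z0 + psum (fun n => RtoC (INR n) * qseq a z0 n) z0 + -1 *
   (psum (fun n => RtoC (INR n) * qseq a z0 n) z0 - RtoC (INR 0) * qseq a z0 0 * z0 ^ 0))
  by (simpl; ring).
refine (has_sum_ext _ _ _ _ E); intros n; unfold dseq.
rewrite S_INR, RtoC_plus, (qseq_rec a z0 n Ha Hz); simpl; ring.
Qed.

(** The difference quotient is bounded on a disk [|z| <= x] with [|z0| < x < 1], so [psum a] is
    Lipschitz at [z0]. Only a bound on the quotient is used, which avoids a circular appeal to its
    continuity. *)
Lemma psum_cont (a : nat -> C) (z0 : C) : disk_seq a -> in_disk z0 -> cont (psum a) z0.
Proof.
intros Ha Hz0 e He.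
assert (Hq := disk_seq_qseq a z0 Ha Hz0).
assert (H0 := Cmod_ge_0 z0).
set (x := ((1 + Cmod z0) / 2)%R).
unfold in_disk in Hz0.
destruct (disk_seq_geom _ x Hq) as [q [M [Hxq [HM [_ H]]]]]; [unfold x; lra|].
assert (Ht : (0 <= x / q < 1)%R) by (apply ratio_lt_1; unfold x in *; lra).
set (K := (M * / (1 - x / q))%R).
assert (HK : (0 <= K)%R).
  apply Rmult_le_pos; auto; apply Rlt_le, Rinv_0_lt_compat; lra.
exists (Rmin (x - Cmod z0) (e / (K + 1))); split.
  apply Rmin_glb_lt; [unfold x; lra | apply Rdiv_lt_0_compat; lra].
intros z Hz.
assert (A := Rlt_le_trans _ _ _ Hz (Rmin_l _ _)).
assert (B := Rlt_le_trans _ _ _ Hz (Rmin_r _ _)).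
assert (Hzx : (Cmod z <= x)%R) by (generalize (Cmod_sub_ge z z0); lra).
assert (Hz1 : in_disk z) by (unfold in_disk; lra).
rewrite (psum_quotient a z0 z Ha Hz0 Hz1).
replace (psum a z0 + (z - z0) * psum (qseq a z0) z - psum a z0)
  with ((z - z0) * psum (qseq a z0) z) by ring.
rewrite Cmod_mult.
assert (C1 : (Cmod (psum (qseq a z0) z) <= K)%R).
  refine (has_sum_norm_le _ _ _ _ _ (psum_correct _ _ Hq Hz1)
    (is_series_geom_scal M _ Ht)).
  intros n; rewrite Cmod_mult, Cmod_pow; apply H; split; auto; apply Cmod_ge_0.
apply Rle_lt_trans with (Cmod (z - z0) * (K + 1))%R.
  apply Rmult_le_compat_l; [apply Cmod_ge_0 | lra].
apply Rmult_lt_compat_r with (r := (K + 1)%R) in B; [|lra].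
unfold Rdiv in B; rewrite Rmult_assoc, Rinv_l in B; lra.
Qed.

Lemma near_psum_quotient (a : nat -> C) (z0 : C) :
  disk_seq a -> in_disk z0 ->
  near z0 (fun z => psum a z = psum a z0 + (z - z0) * psum (qseq a z0) z).
Proof.
intros Ha Hz0; generalize (near_disk z0 Hz0); apply near_imp; intros z Hz.
now apply psum_quotient.
Qed.

Lemma psum_analytic (a : nat -> C) (z0 : C) :
  disk_seq a -> in_disk z0 -> analytic (psum a) z0.
Proof.
intros Ha Hz0 n; revert a Ha; induction n as [|n IH]; intros a Ha.
  now apply psum_cont.
exists (psum (qseq a z0)); split; [now apply IH, disk_seq_qseq|].
now apply near_psum_quotient.
Qed.

Lemma psum_derive (a : nat -> C) (z0 : C) :
  disk_seq a -> in_disk z0 ->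
  @is_derive C_AbsRing C_NormedModule (psum a) z0 (psum (dseq a) z0).
Proof.
intros Ha Hz0; rewrite <- psum_qseq_diag; auto.
apply is_derive_quotient; [|now apply near_psum_quotient].
now apply psum_cont; [apply disk_seq_qseq|].
Qed.

Lemma psum_0 (a : nat -> C) : disk_seq a -> psum a 0 = a O.
Proof.
intros Ha; rewrite psum_split; auto; [ring|].
unfold in_disk; rewrite Cmod_0; lra.
Qed.

Definition conv (a b : nat -> C) (n : nat) : C :=
  @sum_n C_AbelianMonoid (fun k => a k * b (n - k)%nat) n.

Lemma psum_mult (a b : nat -> C) (z : C) :
  disk_seq a -> disk_seq b -> in_disk z ->
  psum (conv a b) z = psum a z * psum b z.
Proof.
intros Ha Hb Hz; apply has_sum_psum.
generalize (has_sum_mult _ _ _ _ (psum_correct a z Ha Hz) (psum_correct b z Hb Hz)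
  (disk_seq_abs a z Ha Hz) (disk_seq_abs b z Hb Hz)).
apply has_sum_ext; intros n; unfold conv.
rewrite Cmult_comm.
rewrite <- (sum_n_mult_l (K := C_Ring) (z ^ n : C)).
apply sum_n_ext_loc; intros k Hk.
change (a k * z ^ k * (b (n - k)%nat * z ^ (n - k)) = z ^ n * (a k * b (n - k)%nat)).
replace (z ^ n) with (z ^ k * z ^ (n - k)); [ring|].
rewrite <- Cpow_add_r; f_equal; lia.
Qed.

(** * The maximum principle and the Schwarz–Pick lemma *)

Lemma Cmod_le_components (z : C) (d : R) :
  (Rabs (Re z) < d)%R -> (Rabs (Im z) < d)%R -> (Cmod z < 2 * d)%R.
Proof.
intros H1 H2; eapply Rle_lt_trans; [apply Cmod_2Rmax|].
assert (Hs : (sqrt 2 < 2)%R).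
  rewrite <- (sqrt_Rsqr 2) at 2 by lra; apply sqrt_lt_1_alt; unfold Rsqr; lra.
assert (Hm : (Rmax (Rabs (fst z)) (Rabs (snd z)) < d)%R) by now apply Rmax_lub_lt.
generalize (Rabs_pos (Re z)) (sqrt_pos 2) (Rle_trans _ _ _ (Rabs_pos _) (Rmax_l (Rabs (fst z)) (Rabs (snd z)))).
intros; nra.
Qed.

Lemma list_argmax {T : Type} (v : T -> R) (l : list T) (t : T) :
  In t l -> exists m, In m l /\ forall y, In y l -> (v y <= v m)%R.
Proof.
revert t; induction l as [|s l IH]; intros t; [easy|]; intros _.
destruct l as [|s' l].
  exists s; split; [now left|]; intros y [->|[]]; apply Rle_refl.
destruct (IH s' (or_introl eq_refl)) as [m [Hm1 Hm2]].
destruct (Rle_dec (v s) (v m)) as [L|L].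
- exists m; split; [now right|]; intros y [<-|Hy]; auto.
- exists s; split; [now left|]; intros y [<-|Hy]; [lra|].
  specialize (Hm2 y Hy); lra.
Qed.

(** If no maximum existed, every point would have a neighbourhood on which [u] stays below its value
    at some point of the disk. Finitely many neighbourhoods cover the disk, and the best of their
    witnesses would lie below another one. *)
Lemma disk_argmax (u : C -> R) (r : R) :
  (0 <= r)%R ->
  (forall z, (Cmod z <= r)%R -> forall e, (0 < e)%R ->
     near z (fun y => (Rabs (u y - u z) < e)%R)) ->
  exists z, (Cmod z <= r)%R /\ forall y, (Cmod y <= r)%R -> (u y <= u z)%R.
Proof.
intros Hr Hu; apply NNPP; intros HN.
assert (Hup : forall z, (Cmod z <= r)%R ->
  exists c, (Cmod c <= r)%R /\ (u z < u c)%R).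
  intros z Hz; apply NNPP; intros H; apply HN; exists z; split; auto.
  intros y Hy; apply Rnot_lt_le; intros L; apply H; now exists y.
(* The factor 2 is there because the compactness theorem controls each coordinate separately, and
   two coordinates below [d] give only a modulus below [2 d]. *)
assert (Hloc : forall t : C, exists p : posreal * C, (Cmod (snd p) <= r)%R /\
  forall y : C, (Cmod (y - t) < 2 * fst p)%R -> (Cmod y <= r)%R ->
    (u y < u (snd p))%R).
  intros t; destruct (Rle_dec (Cmod t) r) as [Ht|Ht].
  - destruct (Hup t Ht) as [c [Hc1 Hc2]].
    destruct (Hu t Ht (u c - u t)%R) as [d [Hd Hn]]; [lra|].
    assert (Hd2 : (0 < d / 2)%R) by lra.
    exists (mkposreal _ Hd2, c); simpl; split; auto; intros y Hy _.
    generalize (Hn y ltac:(lra)) (Rle_abs (u y - u t)); lra.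
  (* A centre [t] outside the disk gets a neighbourhood that misses the disk; its witness 0 is
     arbitrary. *)
  - assert (Hd2 : (0 < (Cmod t - r) / 2)%R) by lra.
    exists (mkposreal _ Hd2, RtoC 0); simpl; split; [rewrite Cmod_0; lra|].
    intros y Hy Hy'; generalize (Cmod_sub_ge t y); rewrite Cmod_minus_sym; lra.
set (pick := fun t : C => proj1_sig (constructive_indefinite_description _ (Hloc t))).
assert (Hpick : forall t : C, (Cmod (snd (pick t)) <= r)%R /\
  forall y : C, (Cmod (y - t) < 2 * fst (pick t))%R -> (Cmod y <= r)%R ->
    (u y < u (snd (pick t)))%R).
  intros t; exact (proj2_sig (constructive_indefinite_description _ (Hloc t))).
clearbody pick.
set (tc := fun t : Compactness.Tn 2 R => (fst t, fst (snd t)) : C).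
refine (compactness_list 2 (- r, (- r, tt))%R (r, (r, tt)) (fun t => fst (pick (tc t))) _).
intros [l Hl].
assert (Hcov : forall y : C, (Cmod y <= r)%R ->
  exists t, In t l /\ (u y < u (snd (pick (tc t))))%R).
  intros y Hy.
  assert (B1 := Rle_trans _ _ _ (re_le_Cmod y) Hy).
  assert (B2 : (Rabs (Im y) <= r)%R).
    eapply Rle_trans; [apply Cmod_ge_Im | exact Hy].
  destruct (Hl (Re y, (Im y, tt))) as [[t1 [t2 []]] [Ht1 [_ [H1 [H2 _]]]]].
    split; [now apply Rabs_le_between | split; [now apply Rabs_le_between | exact I]].
  exists (t1, (t2, tt)); split; auto.
  apply (proj2 (Hpick _)); auto.
  apply Cmod_le_components; auto.
destruct (Hcov 0) as [t0 [Ht0 _]]; [rewrite Cmod_0; auto|].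
destruct (list_argmax (fun t => u (snd (pick (tc t)))) l t0 Ht0) as [m [Hm1 Hm2]].
destruct (Hcov _ (proj1 (Hpick (tc m)))) as [t [Ht1 Ht2]].
generalize (Hm2 t Ht1); lra.
Qed.

Lemma Rmult_ge_abs (a y c : R) : (Rabs y <= c)%R -> (- (Rabs a * c) <= a * y)%R.
Proof.
intros H; generalize (Rmult_le_compat_l _ _ _ (Rabs_pos a) H).
rewrite <- Rabs_mult; generalize (Rabs_maj2 (a * y)); lra.
Qed.

Definition nsq (z : C) : R := (Re z ^ 2 + Im z ^ 2)%R.

Lemma nsq_Cmod (z : C) : nsq z = (Cmod z ^ 2)%R.
Proof. symmetry; apply Cmod2_alt. Qed.

(* Sum the inequality [u <= u z0] over the four points [z0 + h], with
   [h = d, -d, i d, -i d]: in [|phi (z0 + h)| ^ 2] the terms with [h] and with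
   [h ^ 2] cancel up to [o(d ^ 2)], those with [|h| ^ 2] are nonnegative, and
   [eps * nsq] contributes [4 eps d ^ 2]. *)
Lemma no_local_max (phi : C -> C) (z0 : C) (eps : R) :
  smooth 2 phi z0 -> (0 < eps)%R ->
  ~ near z0 (fun z => (nsq (phi z) + eps * nsq z <= nsq (phi z0) + eps * nsq z0)%R).
Proof.
intros [phi1 [[q [Hq E1]] E0]] He Hmax.
set (A := phi z0) in *; set (B := phi1 z0) in *.
set (S := (Rabs (Re A) + Rabs (Im A) + Rabs (Re B) + Rabs (Im B) + 1)%R).
assert (P1 := Rabs_pos (Re A)); assert (P2 := Rabs_pos (Im A)).
assert (P3 := Rabs_pos (Re B)); assert (P4 := Rabs_pos (Im B)).
assert (HS : (1 <= S)%R) by (unfold S; lra).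
(* In [U] and [V] below, the values of [q] enter through combinations in which [q z0] cancels, so
   each is at most [4 * eta]. With this [eta], [2 U + 2 d V >= - 2 eps], which leaves part of the
   gain [4 eps]. *)
set (eta := (eps / (4 * S))%R).
assert (Heta : (0 < eta)%R) by (apply Rdiv_lt_0_compat; lra).
assert (HeS : (4 * (eta * S) = eps)%R) by (unfold eta; field; lra).
destruct (near_and _ _ _ (near_and _ _ _ E0 E1) (near_and _ _ _ (Hq _ Heta) Hmax))
  as [d0 [Hd0 Hn]].
set (d := Rmin 1 (d0 / 2)).
assert (Hd : (0 < d)%R) by (apply Rmin_glb_lt; lra).
assert (Hd1 : (d <= 1)%R) by apply Rmin_l.
assert (Hd2 : (d < d0)%R) by (generalize (Rmin_r 1 (d0 / 2)); fold d; lra).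
assert (Hpt : forall h : C, Cmod h = d -> exists w : C,
  (Rabs (Re w - Re (q z0)) <= eta)%R /\ (Rabs (Im w - Im (q z0)) <= eta)%R /\
  (nsq (A + h * (B + h * w)) + eps * nsq (z0 + h) <= nsq A + eps * nsq z0)%R).
  intros h Hh; destruct (Hn (z0 + h)) as [[F0 F1] [F2 F3]].
    replace (z0 + h - z0) with h by ring; lra.
  exists (q (z0 + h)); repeat split.
  - left; eapply Rle_lt_trans; [|exact F2].
    exact (re_le_Cmod (q (z0 + h) - q z0)).
  - left; eapply Rle_lt_trans; [|exact F2].
    exact (Cmod_ge_Im (q (z0 + h) - q z0)).
  - rewrite F0, F1 in F3; replace (z0 + h - z0) with h in F3 by ring; exact F3.
assert (M1 : Cmod (d, 0%R) = d).
  change (d, 0%R) with (RtoC d); rewrite Cmod_R; apply Rabs_right; lra.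
assert (M3 : Cmod (0%R, d) = d).
  replace (0%R, d) with (Ci * (d, 0%R)).
    rewrite Cmod_mult, Cmod_Ci, M1; ring.
  unfold Ci, Cmult; simpl; f_equal; ring.
assert (M2 : Cmod ((- d)%R, 0%R) = d).
  replace ((- d)%R, 0%R) with (- (d, 0%R)); [now rewrite Cmod_opp|].
  unfold Copp; simpl; f_equal; ring.
assert (M4 : Cmod (0%R, (- d)%R) = d).
  replace (0%R, (- d)%R) with (- (0%R, d)); [now rewrite Cmod_opp|].
  unfold Copp; simpl; f_equal; ring.
destruct (Hpt _ M1) as [[w1 v1] [X1 [Y1 I1]]], (Hpt _ M2) as [[w2 v2] [X2 [Y2 I2]]],
  (Hpt _ M3) as [[w3 v3] [X3 [Y3 I3]]], (Hpt _ M4) as [[w4 v4] [X4 [Y4 I4]]].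
clear Hpt Hn E0 E1 Hq Hmax.
destruct (q z0) as [q1 q2]; destruct A as [a1 a2], B as [b1 b2], z0 as [x y].
unfold nsq, Cmult, Cplus, Re, Im in *; simpl fst in *; simpl snd in *.
apply Rabs_le_between in X1, X2, X3, X4, Y1, Y2, Y3, Y4.
assert (G1 := Rmult_ge_abs a1 (w1 + w2 - w3 - w4) (4 * eta) ltac:(apply Rabs_le; lra)).
assert (G2 := Rmult_ge_abs a2 (v1 + v2 - v3 - v4) (4 * eta) ltac:(apply Rabs_le; lra)).
assert (G3 := Rmult_ge_abs b1 (w1 - w2 - v3 + v4) (4 * eta) ltac:(apply Rabs_le; lra)).
assert (G4 := Rmult_ge_abs b2 (v1 - v2 + w3 - w4) (4 * eta) ltac:(apply Rabs_le; lra)).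
set (U := (a1 * (w1 + w2 - w3 - w4) + a2 * (v1 + v2 - v3 - v4))%R).
set (V := (b1 * (w1 - w2 - v3 + v4) + b2 * (v1 - v2 + w3 - w4))%R).
assert (K : (d ^ 2 * (4 * eps + 4 * (b1 ^ 2 + b2 ^ 2) + 2 * U + 2 * d * V
   + d ^ 2 * (w1 ^ 2 + v1 ^ 2 + w2 ^ 2 + v2 ^ 2 + w3 ^ 2 + v3 ^ 2 + w4 ^ 2 + v4 ^ 2)) <= 0)%R).
  unfold U, V; lra.
assert (KU : (- (4 * eta * (Rabs a1 + Rabs a2)) <= U)%R) by (unfold U; lra).
assert (KV : (- (4 * eta * (Rabs b1 + Rabs b2)) <= V)%R) by (unfold V; lra).
assert (KV' : (- (4 * eta * (Rabs b1 + Rabs b2)) <= d * V)%R).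
  assert (0 <= 4 * eta * (Rabs b1 + Rabs b2))%R by (apply Rmult_le_pos; lra).
  apply Rmult_le_compat_l with (r := d) in KV; nra.
assert (KE : (4 * eta * (Rabs a1 + Rabs a2) + 4 * eta * (Rabs b1 + Rabs b2) <= eps)%R).
  unfold S in HeS; lra.
assert (0 < d ^ 2)%R by now apply pow_lt.
assert (0 <= d ^ 2 * (w1 ^ 2 + v1 ^ 2 + w2 ^ 2 + v2 ^ 2 + w3 ^ 2 + v3 ^ 2 + w4 ^ 2 + v4 ^ 2))%R.
  apply Rmult_le_pos; [lra|]; repeat apply Rplus_le_le_0_compat; apply pow2_ge_0.
generalize (pow2_ge_0 b1) (pow2_ge_0 b2); intros.
apply (Rlt_not_le _ _ (Rmult_lt_0_compat _ (4 * eps + 4 * (b1 ^ 2 + b2 ^ 2) + 2 * U + 2 * d * V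
   + d ^ 2 * (w1 ^ 2 + v1 ^ 2 + w2 ^ 2 + v2 ^ 2 + w3 ^ 2 + v3 ^ 2 + w4 ^ 2 + v4 ^ 2))%R
   H ltac:(lra)) K).
Qed.

Lemma near_nsq (g : C -> C) (z0 : C) (e : R) :
  cont g z0 -> (0 < e)%R -> near z0 (fun z => (Rabs (nsq (g z) - nsq (g z0)) < e)%R).
Proof.
intros Hg He; set (K := (2 * Cmod (g z0) + 1)%R).
assert (HK : (1 <= K)%R) by (generalize (Cmod_ge_0 (g z0)); unfold K; lra).
assert (Hd : (0 < Rmin 1 (e / K))%R).
  apply Rmin_glb_lt; [lra | apply Rdiv_lt_0_compat; lra].
generalize (Hg _ Hd); apply near_imp; intros z Hz.
assert (A := Rlt_le_trans _ _ _ Hz (Rmin_l _ _)).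
assert (B := Rlt_le_trans _ _ _ Hz (Rmin_r _ _)).
rewrite !nsq_Cmod.
assert (F : (Rabs (Cmod (g z) - Cmod (g z0)) <= Cmod (g z - g z0))%R).
  apply Rabs_le; generalize (Cmod_sub_ge (g z) (g z0)) (Cmod_sub_ge (g z0) (g z)).
  rewrite (Cmod_minus_sym (g z0)); lra.
replace (Cmod (g z) ^ 2 - Cmod (g z0) ^ 2)%R with
  ((Cmod (g z) - Cmod (g z0)) * (Cmod (g z) + Cmod (g z0)))%R by ring.
rewrite Rabs_mult, (Rabs_right (Cmod (g z) + Cmod (g z0))).
  2: generalize (Cmod_ge_0 (g z)) (Cmod_ge_0 (g z0)); lra.
assert (G : (Cmod (g z) + Cmod (g z0) <= K)%R).
  unfold K; generalize (Cmod_sub_ge (g z) (g z0)); lra.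
apply Rle_lt_trans with (Cmod (g z - g z0) * K)%R.
  apply Rmult_le_compat; auto; [apply Rabs_pos|].
  generalize (Cmod_ge_0 (g z)) (Cmod_ge_0 (g z0)); lra.
apply Rmult_lt_compat_r with (r := K) in B; [|lra].
unfold Rdiv in B; rewrite Rmult_assoc, Rinv_l in B; lra.
Qed.

(** The perturbed function [|phi|^2 + eps |z|^2] attains its maximum on the closed disk, by the
    previous lemmas only on the circle, where it is at most [M^2 + eps]. Then [eps] tends to 0. *)
Lemma maximum_principle (phi : C -> C) (r M : R) :
  (0 < r < 1)%R -> (forall z, in_disk z -> smooth 2 phi z) ->
  (forall z, Cmod z = r -> (Cmod (phi z) <= M)%R) ->
  forall z, (Cmod z <= r)%R -> (Cmod (phi z) <= M)%R.
Proof.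
intros Hr Hs HM.
assert (HM0 : (0 <= M)%R).
  eapply Rle_trans; [apply Cmod_ge_0 | apply (HM (RtoC r))].
  rewrite Cmod_R; apply Rabs_right; lra.
assert (H : forall eps, (0 < eps)%R -> forall z, (Cmod z <= r)%R ->
          (Cmod (phi z) ^ 2 <= M ^ 2 + eps)%R).
  intros eps He.
  destruct (disk_argmax (fun z => nsq (phi z) + eps * nsq z)%R r) as [z0 [Hz0 Hmax]].
  - lra.
  - intros z Hz e He'.
    assert (Hc : cont phi z).
      apply (smooth_cont 2), Hs; unfold in_disk; lra.
    generalize (near_and _ _ _ (near_nsq phi z (e / 2) Hc ltac:(lra))
      (near_nsq _ z (e / 2 / eps) (cont_id z) ltac:(apply Rdiv_lt_0_compat; lra))).
    apply near_imp; intros y [F G].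
    replace (nsq (phi y) + eps * nsq y - (nsq (phi z) + eps * nsq z))%R
      with ((nsq (phi y) - nsq (phi z)) + eps * (nsq y - nsq z))%R by ring.
    eapply Rle_lt_trans; [apply Rabs_triang|].
    rewrite Rabs_mult, (Rabs_right eps) by lra.
    apply Rmult_lt_compat_l with (r := eps) in G; auto.
    replace (eps * (e / 2 / eps))%R with (e / 2)%R in G by (field; lra); lra.
  - destruct (Rle_lt_or_eq_dec _ _ Hz0) as [L|L].
    + exfalso; apply (no_local_max phi z0 eps); auto.
        apply Hs; unfold in_disk; lra.
      exists (r - Cmod z0)%R; split; [lra|]; intros z Hz; apply Hmax.
      generalize (Cmod_sub_ge z z0); lra.
    + intros z Hz; generalize (Hmax z Hz); simpl.
      rewrite !nsq_Cmod, L; intros K.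
      assert (Cmod (phi z0) ^ 2 <= M ^ 2)%R.
        apply pow_incr; split; [apply Cmod_ge_0 | now apply HM].
      assert (0 <= eps * Cmod z ^ 2)%R by (apply Rmult_le_pos; [lra | apply pow2_ge_0]).
      assert (r ^ 2 <= 1)%R by nra.
      assert (eps * r ^ 2 <= eps)%R by nra.
      simpl in *; lra.
intros z Hz; apply Rnot_lt_le; intros L.
assert (K : (0 < Cmod (phi z) ^ 2 - M ^ 2)%R) by nra.
generalize (H ((Cmod (phi z) ^ 2 - M ^ 2) / 2)%R ltac:(lra) z Hz); lra.
Qed.

Definition disk_analytic (g : C -> C) : Prop := forall z, in_disk z -> analytic g z.

Lemma in_disk_0 : in_disk 0.
Proof. unfold in_disk; rewrite Cmod_0; lra. Qed.

(** Each order of smoothness at 0 supplies its own quotient; continuity forces all of them to share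
    the value at 0, so a single [g1] serves every order. The equation holds on all of [C], which
    frees later expansions from side conditions. *)
Lemma disk_division (g : C -> C) :
  disk_analytic g ->
  exists g1, disk_analytic g1 /\ forall z, g z = g 0 + z * g1 z.
Proof.
intros Hg; destruct (Hg 0 in_disk_0 1%nat) as [h [Hh Eh]].
set (g1 := fun z => if Ceq_dec z 0 then h 0 else (g z - g 0) * / z).
assert (G0 : g1 0 = h 0) by (unfold g1; destruct (Ceq_dec 0 0) as [|N]; [reflexivity | elim (N eq_refl)]).
assert (G1 : forall z : C, z <> 0 -> g1 z = (g z - g 0) * / z).
  intros z Hz; unfold g1; destruct (Ceq_dec z 0) as [N|]; [elim (Hz N) | reflexivity].
exists g1; split.
- intros z0 Hz0 n; destruct (Ceq_dec z0 0) as [->|N].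
  + destruct (Hg 0 in_disk_0 (S n)) as [k [Hk Ek]].
    assert (Q : forall w z : C, z <> 0 -> g z = g 0 + (z - 0) * w -> (g z - g 0) * / z = w).
      intros w z Hz ->; field; auto.
    assert (E : k 0 = h 0).
      apply cont_unique; auto; [apply (smooth_cont n); auto|].
      generalize (near_and _ _ _ Eh Ek); apply near_imp; intros z [E1 E2] Hz.
      now rewrite <- (Q _ _ Hz E1), <- (Q _ _ Hz E2).
    apply smooth_ext with k; auto.
    revert Ek; apply near_imp; intros z E2.
    destruct (Ceq_dec z 0) as [->|Hz]; [congruence|].
    now rewrite (G1 z Hz), (Q _ _ Hz E2).
  + apply smooth_ext with (fun z => (g z + - g 0) * / z).
      generalize (near_neq _ _ N); apply near_imp; intros z Hz.
      now rewrite (G1 z Hz).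
    apply smooth_mult; [|apply smooth_inv; auto; apply smooth_id].
    apply smooth_plus; [now apply Hg | apply smooth_const].
- intros z; destruct (Ceq_dec z 0) as [->|Hz]; [ring|].
  rewrite (G1 z Hz); field; auto.
Qed.

(** On the circle of radius [r] the hypothesis gives [|g| <= 1 / r]. If [|g z| > 1], an [r < 1]
    exceeding both [|z|] and [1 / |g z|] contradicts the maximum principle. *)
Lemma schwarz (g : C -> C) :
  disk_analytic g -> (forall z, in_disk z -> (Cmod (z * g z) <= 1)%R) ->
  forall z, in_disk z -> (Cmod (g z) <= 1)%R.
Proof.
unfold in_disk; intros Hg H z Hz; apply Rnot_lt_le; intros L.
assert (Hi : (/ Cmod (g z) < 1)%R).
  rewrite <- Rinv_1; apply Rinv_lt_contravar; lra.
assert (Hi0 : (0 < / Cmod (g z))%R) by (apply Rinv_0_lt_compat; lra).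
set (m := Rmax (Cmod z) (/ Cmod (g z))).
assert (m1 : (Cmod z <= m)%R) by apply Rmax_l.
assert (m2 : (/ Cmod (g z) <= m)%R) by apply Rmax_r.
assert (m3 : (m < 1)%R) by now apply Rmax_lub_lt.
set (r := ((1 + m) / 2)%R).
assert (K : (Cmod (g z) <= / r)%R).
  apply (maximum_principle g r); [unfold r; lra | intros; now apply Hg | | unfold r; lra].
  intros y Hy; apply Rmult_le_reg_l with r; [unfold r; lra|].
  rewrite Rinv_r by (unfold r; lra).
  rewrite <- Hy, <- Cmod_mult; apply H; rewrite Hy; unfold r; lra.
assert (J : (/ r < Cmod (g z))%R).
  rewrite <- (Rinv_inv (Cmod (g z))); apply Rinv_lt_contravar; [|unfold r; lra].
  apply Rmult_lt_0_compat; unfold r; lra.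
lra.
Qed.

Lemma moebius_le (a w : C) :
  (Cmod a <= 1)%R -> (Cmod w <= 1)%R -> (Cmod (w - a) <= Cmod (1 - Cconj a * w))%R.
Proof.
intros Ha Hw.
apply Rsqr_incr_0_var; [|apply Cmod_ge_0]; rewrite !Rsqr_pow2.
assert (E : (Cmod (1 - Cconj a * w) ^ 2 - Cmod (w - a) ^ 2 =
  (1 - Cmod a ^ 2) * (1 - Cmod w ^ 2))%R).
  rewrite !Cmod2_alt; destruct a, w; unfold Re, Im; simpl; ring.
assert (0 <= (1 - Cmod a ^ 2) * (1 - Cmod w ^ 2))%R.
  generalize (Cmod_ge_0 a) (Cmod_ge_0 w); intros.
  apply Rmult_le_pos; nra.
lra.
Qed.

Lemma one_minus_neq_0 (a w : C) :
  (Cmod a < 1)%R -> (Cmod w <= 1)%R -> 1 - Cconj a * w <> 0.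
Proof.
intros Ha Hw E; assert (F : Cconj a * w = 1).
  replace (Cconj a * w) with (1 - (1 - Cconj a * w)) by ring; rewrite E; ring.
apply (f_equal Cmod) in F; rewrite Cmod_mult, Cmod_conj, Cmod_1 in F.
generalize (Cmod_ge_0 a) (Cmod_ge_0 w); nra.
Qed.

Lemma one_minus_conj (a : C) : 1 - Cconj a * a = RtoC (1 - Cmod a ^ 2).
Proof.
rewrite RtoC_minus, Cmod2_conj; ring.
Qed.

(** The numerator [d] is left unrelated to [phi] because two different numerators are needed in the
    second-order step. *)
Lemma moebius_quotient_analytic (phi d : C -> C) :
  disk_analytic phi -> disk_analytic d ->
  (forall z, in_disk z -> (Cmod (phi z) <= 1)%R) -> (Cmod (phi 0) < 1)%R ->
  disk_analytic (fun z => d z * / (1 - Cconj (phi 0) * phi z)).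
Proof.
intros Hp Hd H1 H0 z Hz n.
apply smooth_mult; [now apply Hd|]; apply smooth_inv.
- apply smooth_ext with (fun z => 1 + (- Cconj (phi 0)) * phi z).
    apply near_all; intros; ring.
  apply smooth_plus; [apply smooth_const|].
  apply smooth_mult; [apply smooth_const | now apply Hp].
- now apply one_minus_neq_0; auto.
Qed.

(** Multiplied by z, the quotient is the image of [phi z] under the Möbius map taking [phi 0] to 0,
    hence at most 1 in modulus; Schwarz's lemma removes the factor z. *)
Lemma moebius_quotient_le (phi d : C -> C) :
  disk_analytic phi -> disk_analytic d ->
  (forall z, in_disk z -> (Cmod (phi z) <= 1)%R) -> (Cmod (phi 0) < 1)%R ->
  (forall z, phi z = phi 0 + z * d z) ->
  forall z, in_disk z -> (Cmod (d z * / (1 - Cconj (phi 0) * phi z)) <= 1)%R.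
Proof.
intros Hp Hd H1 H0 E.
apply (schwarz (fun z => d z * / (1 - Cconj (phi 0) * phi z))).
  now apply moebius_quotient_analytic.
intros z Hz.
assert (N := one_minus_neq_0 _ _ H0 (H1 z Hz)).
replace (z * (d z * / (1 - Cconj (phi 0) * phi z)))
  with ((phi z - phi 0) * / (1 - Cconj (phi 0) * phi z)).
  2: { replace (phi z - phi 0) with (z * d z) by (rewrite (E z); ring); ring. }
rewrite Cmod_mult, Cmod_inv by auto.
assert (P : (0 < Cmod (1 - Cconj (phi 0) * phi z))%R) by now apply Cmod_gt_0.
apply Rmult_le_reg_r with (1 := P).
rewrite Rmult_assoc, Rinv_l, Rmult_1_r, Rmult_1_l by lra.
apply moebius_le; auto; lra.
Qed.

Lemma schwarz_pick_strict (phi d : C -> C) :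
  disk_analytic phi -> disk_analytic d ->
  (forall z, in_disk z -> (Cmod (phi z) <= 1)%R) -> (Cmod (phi 0) < 1)%R ->
  (forall z, phi z = phi 0 + z * d z) ->
  (Cmod (d 0) <= 1 - Cmod (phi 0) ^ 2)%R.
Proof.
intros Hp Hd H1 H0 E.
generalize (moebius_quotient_le phi d Hp Hd H1 H0 E 0 in_disk_0).
assert (N := one_minus_neq_0 _ _ H0 (H1 0 in_disk_0)).
assert (P : (0 < 1 - Cmod (phi 0) ^ 2)%R) by (generalize (Cmod_ge_0 (phi 0)); nra).
rewrite Cmod_mult, Cmod_inv by auto.
rewrite one_minus_conj, Cmod_R, Rabs_right by lra.
intros K; apply Rmult_le_compat_r with (r := (1 - Cmod (phi 0) ^ 2)%R) in K; [|lra].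
rewrite Rmult_assoc, Rinv_l, Rmult_1_r, Rmult_1_l in K; lra.
Qed.

Lemma scal_analytic (c : C) (phi : C -> C) :
  disk_analytic phi -> disk_analytic (fun z => c * phi z).
Proof.
intros H z Hz n; apply smooth_mult; [apply smooth_const | now apply H].
Qed.

Lemma Cmod_scal (t : R) (z : C) : (0 <= t)%R -> Cmod (RtoC t * z) = (t * Cmod z)%R.
Proof. intros Ht; rewrite Cmod_mult, Cmod_R, Rabs_right; lra. Qed.

Lemma schwarz_pick (phi d : C -> C) :
  disk_analytic phi -> disk_analytic d ->
  (forall z, in_disk z -> (Cmod (phi z) <= 1)%R) ->
  (forall z, phi z = phi 0 + z * d z) ->
  (Cmod (d 0) <= 1 - Cmod (phi 0) ^ 2)%R.
Proof.
intros Hp Hd H1 E.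
assert (B0 := H1 0 in_disk_0); assert (B1 := Cmod_ge_0 (phi 0)).
assert (K : forall t, (0 < t < 1)%R ->
  (t * Cmod (d 0) <= 1 - (t * Cmod (phi 0)) ^ 2)%R).
  intros t Ht; rewrite <- !Cmod_scal by lra.
  apply (schwarz_pick_strict (fun z => RtoC t * phi z) (fun z => RtoC t * d z)).
  - now apply scal_analytic.
  - now apply scal_analytic.
  - intros z Hz; rewrite Cmod_scal by lra.
    generalize (H1 z Hz) (Cmod_ge_0 (phi z)); nra.
  - rewrite Cmod_scal by lra; nra.
  - intros z; rewrite E; ring.
assert (D0 := Cmod_ge_0 (d 0)).
set (x := Cmod (phi 0)) in *; set (y := Cmod (d 0)) in *.
apply Rnot_lt_le; intros L.
set (s := (y - (1 - x ^ 2))%R).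
(* The scaled inequality bounds the excess [s] by [(1 - t) y + (1 - t^2) x^2 <= (1 - t) (y + 2)];
   this [t] makes that at most [s / 2]. *)
set (t := (1 - Rmin (1 / 2) (s / (2 * (y + 2))))%R).
assert (J1 : (Rmin (1 / 2) (s / (2 * (y + 2))) <= 1 / 2)%R) by apply Rmin_l.
assert (J2 : (Rmin (1 / 2) (s / (2 * (y + 2))) <= s / (2 * (y + 2)))%R) by apply Rmin_r.
assert (J3 : (0 < Rmin (1 / 2) (s / (2 * (y + 2))))%R).
  apply Rmin_glb_lt; [lra|]; apply Rdiv_lt_0_compat; unfold s; lra.
assert (J4 : ((1 - t) * (y + 2) <= s / 2)%R).
  replace (s / 2)%R with (s / (2 * (y + 2)) * (y + 2))%R by (field; lra).
  apply Rmult_le_compat_r; unfold t; lra.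
assert (Ht : (0 < t < 1)%R) by (unfold t; lra).
generalize (K t Ht).
assert ((1 - t ^ 2) * x ^ 2 <= 2 * (1 - t))%R.
  assert (x ^ 2 <= 1)%R by nra.
  assert (0 <= 1 - t ^ 2)%R by nra.
  assert ((1 - t ^ 2) * x ^ 2 <= (1 - t ^ 2) * 1)%R by (apply Rmult_le_compat_l; lra).
  nra.
unfold s in *; rewrite Rpow_mult_distr; lra.
Qed.

(** * A bound on the first three coefficients of a Schwarz function *)

(** One step of Schur's algorithm: [h] is again bounded by 1, with [h(0) = c2 / D] and
    [h'(0) = (c3 D + conj(c1) c2^2) / D^2], where [c3 = chi 0]. The claim is the Schwarz-Pick
    inequality for [h], multiplied by [D^2]. *)
Lemma schur_second_order (phi psi chi : C -> C) :
  disk_analytic phi -> disk_analytic psi -> disk_analytic chi ->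
  (forall z, in_disk z -> (Cmod (phi z) <= 1)%R) -> (Cmod (phi 0) < 1)%R ->
  (forall z, phi z = phi 0 + z * psi z) -> (forall z, psi z = psi 0 + z * chi z) ->
  (Cmod (chi 0 * RtoC (1 - Cmod (phi 0) ^ 2) + Cconj (phi 0) * psi 0 ^ 2)
     <= (1 - Cmod (phi 0) ^ 2) ^ 2 - Cmod (psi 0) ^ 2)%R.
Proof.
intros Hphi Hpsi Hchi H1 H0 E1 E2.
set (c1 := phi 0) in *; set (c2 := psi 0) in *.
set (D := (1 - Cmod c1 ^ 2)%R).
assert (HD : (0 < D)%R) by (unfold D; generalize (Cmod_ge_0 c1); nra).
assert (HDC : RtoC D <> 0) by (intros F; injection F; lra).
assert (ED : 1 - Cconj c1 * c1 = RtoC D) by apply one_minus_conj.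
set (h := fun z => psi z * / (1 - Cconj c1 * phi z)).
assert (Hh : disk_analytic h) by now apply moebius_quotient_analytic.
(* Clearing denominators in [h z - h 0] and inserting the expansions of [phi] and [psi] cancels
   [c2 D] and leaves [z * k z / D]. So [k / D] is the quotient of [h] in a form that can be
   evaluated at 0. *)
set (k := fun z => (chi z * RtoC D + Cconj c1 * c2 * psi z) * / (1 - Cconj c1 * phi z)).
assert (Hk : disk_analytic k).
  apply moebius_quotient_analytic; auto; intros z Hz n.
  apply smooth_plus; apply smooth_mult;
    first [apply smooth_const | now apply Hchi | now apply Hpsi].
assert (N : forall z, in_disk z -> 1 - Cconj c1 * phi z <> 0).
  intros z Hz; apply one_minus_neq_0; auto.
assert (Eh0 : h 0 = c2 * / RtoC D) by (unfold h; now rewrite <- ED).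
destruct (disk_division h Hh) as [d [Hd Ed]].
assert (Ed0 : d 0 = k 0 * / RtoC D).
  apply (cont_unique d (fun z => k z * / RtoC D) 0).
  - apply (smooth_cont 0), (Hd 0 in_disk_0 0%nat).
  - apply cont_mult; [|apply cont_const].
    apply (smooth_cont 0), (Hk 0 in_disk_0 0%nat).
  - generalize (near_disk 0 in_disk_0); apply near_imp; intros z Hz Hz0.
    assert (F : z * d z = h z - h 0) by (rewrite (Ed z); ring).
    assert (G : d z = (h z - h 0) * / z) by (rewrite <- F; field; auto).
    assert (Nz := N z Hz).
    rewrite G, Eh0; unfold h, k; rewrite <- ED in *.
    assert (EP : phi z = c1 + z * (c2 + z * chi z)) by now rewrite <- E2, <- E1.
    rewrite EP in *; rewrite (E2 z); field; auto.
assert (P := schwarz_pick h d Hh Hd).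
assert (Hh1 : forall z, in_disk z -> (Cmod (h z) <= 1)%R)
  by now apply moebius_quotient_le.
specialize (P Hh1 Ed).
rewrite Ed0, Eh0 in P; unfold k in P; fold c1 c2 in P; rewrite ED in P.
rewrite !Cmod_mult, Cmod_inv, Cmod_R, Rabs_right in P by (auto; lra).
replace (Cconj c1 * c2 * c2) with (Cconj c1 * c2 ^ 2) in P by ring.
apply Rmult_le_compat_r with (r := (D ^ 2)%R) in P; [|nra].
set (X := Cmod (chi 0 * D + Cconj c1 * c2 ^ 2)) in *.
replace (X * / D * / D * D ^ 2)%R with X in P by (field; lra).
replace ((1 - (Cmod c2 * / D) ^ 2) * D ^ 2)%R with (D ^ 2 - Cmod c2 ^ 2)%R in P
  by (field; lra).
exact P.
Qed.

Definition cubic (c1 c2 c3 : C) : C := c3 - c1 * c2 / 3 - c1 ^ 3 / 6.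

Lemma Cmod_inv_3 : Cmod (/ 3) = (/ 3)%R.
Proof.
rewrite Cmod_inv; [rewrite Cmod_R, Rabs_right; lra|].
intros F; injection F; lra.
Qed.

Lemma Cmod_inv_6 : Cmod (/ 6) = (/ 6)%R.
Proof.
rewrite Cmod_inv; [rewrite Cmod_R, Rabs_right; lra|].
intros F; injection F; lra.
Qed.

Lemma cubic_bound_strict (c1 c2 c3 : C) :
  (Cmod c1 < 1)%R ->
  (Cmod (c3 * RtoC (1 - Cmod c1 ^ 2) + Cconj c1 * c2 ^ 2)
     <= (1 - Cmod c1 ^ 2) ^ 2 - Cmod c2 ^ 2)%R ->
  (Cmod (cubic c1 c2 c3) <= 1)%R.
Proof.
intros H1 H.
set (D := (1 - Cmod c1 ^ 2)%R) in *.
assert (Hx := Cmod_ge_0 c1); assert (Hy := Cmod_ge_0 c2).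
assert (HD : (0 < D)%R) by (unfold D; nra).
(* Multiplying by [D] isolates the combination bounded by hypothesis; the remaining terms contain
   only [c1] and [c2] and are estimated by their moduli. *)
assert (E : RtoC D * cubic c1 c2 c3 =
  (c3 * RtoC D + Cconj c1 * c2 ^ 2) +
  (- (Cconj c1 * c2 ^ 2) + - (RtoC D * (c1 * c2 * / 3) + RtoC D * (c1 ^ 3 * / 6)))).
  unfold cubic, Cdiv; ring.
assert (K : (Cmod (RtoC D * cubic c1 c2 c3) <= (D ^ 2 - Cmod c2 ^ 2) +
   (Cmod c1 * Cmod c2 ^ 2 + (D * (Cmod c1 * Cmod c2 * / 3) + D * (Cmod c1 ^ 3 * / 6))))%R).
  rewrite E; eapply Rle_trans; [apply Cmod_triangle|].
  apply Rplus_le_compat; auto.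
  eapply Rle_trans; [apply Cmod_triangle|]; rewrite !Cmod_opp.
  apply Rplus_le_compat.
    right; now rewrite Cmod_mult, Cmod_conj, Cmod_pow.
  eapply Rle_trans; [apply Cmod_triangle|]; right.
  now rewrite !Cmod_mult, Cmod_pow, !Cmod_R, !(Rabs_right D), Cmod_inv_3, Cmod_inv_6 by lra.
rewrite Cmod_scal in K by lra.
apply Rmult_le_reg_l with D; auto; eapply Rle_trans; [exact K|].
set (x := Cmod c1) in *; set (y := Cmod c2) in *.
(* Complete the square in [y]. *)
assert (Q : (0 <= (1 - x) * (y - (1 + x) * x / 6) ^ 2)%R).
  apply Rmult_le_pos; [lra | apply pow2_ge_0].
(* The slack is exactly the square above plus this term: [D x^2 - D x^3 / 6 - (1 - x) (1 + x)^2 x^2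
   / 36 = D x^2 (35 - 7 x) / 36]. *)
assert (L : (0 <= D * (x ^ 2 * (35 - 7 * x) / 36))%R).
  apply Rmult_le_pos; [lra|].
  apply Rmult_le_pos; [|lra]; apply Rmult_le_pos; [apply pow2_ge_0 | lra].
unfold D in *; lra.
Qed.

Lemma cubic_bound (phi psi chi : C -> C) :
  disk_analytic phi -> disk_analytic psi -> disk_analytic chi ->
  (forall z, in_disk z -> (Cmod (phi z) <= 1)%R) ->
  (forall z, phi z = phi 0 + z * psi z) -> (forall z, psi z = psi 0 + z * chi z) ->
  (Cmod (cubic (phi 0) (psi 0) (chi 0)) <= 1)%R.
Proof.
intros Hphi Hpsi Hchi H1 E1 E2.
assert (K : forall t, (0 < t < 1)%R ->
  (Cmod (cubic (RtoC t * phi 0) (RtoC t * psi 0) (RtoC t * chi 0)) <= 1)%R).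
  intros t Ht.
  assert (B : (Cmod (RtoC t * phi 0) < 1)%R).
    rewrite Cmod_scal by lra; generalize (H1 0 in_disk_0) (Cmod_ge_0 (phi 0)); nra.
  apply cubic_bound_strict; auto.
  apply (schur_second_order (fun z => RtoC t * phi z) (fun z => RtoC t * psi z)
           (fun z => RtoC t * chi z)); try now apply scal_analytic.
  - intros z Hz; rewrite Cmod_scal by lra.
    generalize (H1 z Hz) (Cmod_ge_0 (phi z)); nra.
  - exact B.
  - intros z; rewrite E1; ring.
  - intros z; rewrite E2; ring.
set (c1 := phi 0) in *; set (c2 := psi 0) in *; set (c3 := chi 0) in *.
(* The weights are degrees: replacing each coefficient by [t] times itself changes the three terms
   by the factors [1 - t], [1 - t^2], [1 - t^3], at most 1, 2, 3 times [1 - t]. *)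
set (B := (Cmod c3 + 2 * Cmod (c1 * c2 / 3) + 3 * Cmod (c1 ^ 3 / 6))%R).
assert (P1 := Cmod_ge_0 c3); assert (P2 := Cmod_ge_0 (c1 * c2 / 3)).
assert (P3 := Cmod_ge_0 (c1 ^ 3 / 6)).
assert (J : forall t, (0 < t < 1)%R -> (Cmod (cubic c1 c2 c3) <= 1 + (1 - t) * B)%R).
  intros t Ht.
  assert (E : cubic c1 c2 c3 = cubic (RtoC t * c1) (RtoC t * c2) (RtoC t * c3)
    + (RtoC (1 - t) * c3 + (- (RtoC (1 - t ^ 2) * (c1 * c2 / 3)) +
       - (RtoC (1 - t ^ 3) * (c1 ^ 3 / 6))))).
    unfold cubic; rewrite !RtoC_minus, !RtoC_pow; field.
  rewrite E; eapply Rle_trans; [apply Cmod_triangle|].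
  apply Rplus_le_compat; [now apply K|].
  eapply Rle_trans; [apply Cmod_triangle|].
  eapply Rle_trans; [apply Rplus_le_compat_l, Cmod_triangle|].
  rewrite !Cmod_opp, !Cmod_scal by nra; unfold B.
  assert ((1 - t ^ 2) * Cmod (c1 * c2 / 3) <= (2 * (1 - t)) * Cmod (c1 * c2 / 3))%R
    by (apply Rmult_le_compat_r; nra).
  assert (0 <= (1 - t) ^ 2 * (t + 2))%R by (apply Rmult_le_pos; [apply pow2_ge_0 | lra]).
  assert ((1 - t ^ 3) * Cmod (c1 ^ 3 / 6) <= (3 * (1 - t)) * Cmod (c1 ^ 3 / 6))%R
    by (apply Rmult_le_compat_r; lra).
  lra.
apply Rnot_lt_le; intros L.
assert (HB : (0 <= B)%R) by (unfold B; lra).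
set (s := (Cmod (cubic c1 c2 c3) - 1)%R).
set (m := Rmin (1 / 2) (s / (2 * (B + 1)))).
assert (m1 : (m <= 1 / 2)%R) by apply Rmin_l.
assert (m2 : (m <= s / (2 * (B + 1)))%R) by apply Rmin_r.
assert (m3 : (0 < m)%R).
  apply Rmin_glb_lt; [lra|]; apply Rdiv_lt_0_compat; unfold s; lra.
assert (m4 : (m * (B + 1) <= s / 2)%R).
  replace (s / 2)%R with (s / (2 * (B + 1)) * (B + 1))%R by (field; lra).
  apply Rmult_le_compat_r; lra.
generalize (J (1 - m)%R ltac:(lra)); unfold s in *; lra.
Qed.

(** * The series of the logarithm *)

(* Eneström–Kakeya: multiply the series by [1 + z] and bound the telescoping
   coefficients of the product. *)
Lemma psum_neq_0 (c : nat -> C) (v : nat -> R) (z : C) :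
  disk_seq c -> c O <> 0 -> (v O <= Cmod (c O))%R ->
  (forall n, (Cmod (c (S n) + c n) <= v n - v (S n))%R) -> is_lim_seq v 0 ->
  in_disk z -> psum c z <> 0.
Proof.
intros Hc H0 Hv Hd Hl Hz E.
assert (S1 := psum_correct c z Hc Hz); rewrite E in S1.
assert (S2 := has_sum_plus _ _ _ _ (has_sum_shift _ _ S1) (has_sum_scal z _ _ S1)).
assert (T : is_series (fun n => Cmod z * (v n - v (S n)))%R (Cmod z * v O)%R).
  apply (is_series_scal (V := R_NormedModule) (Cmod z) (fun n => v n - v (S n))%R).
  change (is_lim_seq (sum_n (fun n => v n - v (S n))%R) (v O)).
  apply (is_lim_seq_ext (fun n => v O - v (S n))%R).
    intros n; induction n as [|n IH]; [now rewrite sum_O|].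
    rewrite sum_Sn, <- IH; unfold plus; simpl; ring.
  assert (T := is_lim_seq_minus' _ _ _ _ (is_lim_seq_const (v O))
    (proj1 (is_lim_seq_incr_1 v 0) Hl)).
  now rewrite Rminus_0_r in T.
assert (Hz0 := Cmod_ge_0 z); unfold in_disk in Hz.
(* If the sum vanishes, the product series without its constant term sums to [- c 0]. Hence
   [|c 0| <= |z| v 0 <= |z| |c 0|], impossible for [|z| < 1]. *)
assert (B : (Cmod (0 - c O * z ^ 0 + z * 0) <= Cmod z * v O)%R).
  refine (has_sum_norm_le _ _ _ _ _ S2 T); intros n.
  replace (c (S n) * z ^ S n + z * (c n * z ^ n)) with (z * (z ^ n * (c (S n) + c n)))
    by (simpl; ring).
  rewrite Cmod_mult; apply Rmult_le_compat_l; auto.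
  rewrite Cmod_mult, Cmod_pow.
  assert (P : (0 <= Cmod z ^ n <= 1)%R).
    split; [now apply pow_le|].
    replace 1%R with (1 ^ n)%R by apply pow1; apply pow_incr; lra.
  generalize (Hd n) (Cmod_ge_0 (c (S n) + c n)); nra.
replace (0 - c O * z ^ 0 + z * 0) with (- c O) in B by (simpl; ring).
rewrite Cmod_opp in B.
apply Cmod_gt_0 in H0; nra.
Qed.

Definition logseq (n : nat) : C := RtoC ((-1) ^ n / INR (S n)).

Lemma Cmod_alternating (n : nat) (x : R) : (0 <= x)%R -> Cmod (RtoC ((-1) ^ n * x)) = x.
Proof.
intros Hx; rewrite Cmod_R, Rabs_mult, pow_1_abs, Rmult_1_l, Rabs_right; lra.
Qed.

Lemma INR_S_pos (n : nat) : (0 < INR (S n))%R.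
Proof. apply lt_0_INR; lia. Qed.

Lemma disk_seq_logseq : disk_seq logseq.
Proof.
apply disk_seq_bounded with 1%R; intros n; unfold logseq, Rdiv.
assert (H := INR_S_pos n).
rewrite Cmod_alternating by (apply Rlt_le, Rinv_0_lt_compat; lra).
rewrite <- Rinv_1; apply Rinv_le_contravar; [lra|].
rewrite S_INR; generalize (pos_INR n); lra.
Qed.

Lemma is_lim_seq_inv_S (k : nat) : is_lim_seq (fun n => / INR (S (k + n)))%R 0.
Proof.
replace (Finite 0) with (Rbar_inv p_infty) by reflexivity.
apply is_lim_seq_inv; [|easy].
apply (is_lim_seq_ext (fun n => INR (n + S k))); [intros; f_equal; lia|].
apply is_lim_seq_incr_n, is_lim_seq_INR.
Qed.

Lemma psum_logseq_neq_0 (z : C) : in_disk z -> psum logseq z <> 0.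
Proof.
assert (E0 : logseq O = 1) by (unfold logseq; simpl; f_equal; field).
apply (psum_neq_0 logseq (fun n => / INR (S n))%R).
- exact disk_seq_logseq.
- rewrite E0; intros F; injection F; lra.
- rewrite E0, Cmod_1; simpl; lra.
- intros n; unfold logseq; rewrite <- RtoC_plus.
  assert (H1 := INR_S_pos n); assert (H2 := INR_S_pos (S n)).
  assert (H3 : (INR (S (S n)) = INR (S n) + 1)%R) by apply S_INR.
  replace ((-1) ^ S n / INR (S (S n)) + (-1) ^ n / INR (S n))%R
    with ((-1) ^ n * (/ INR (S n) - / INR (S (S n))))%R
    by (simpl pow; field; lra).
  rewrite Cmod_alternating; [lra|].
  generalize (Rinv_le_contravar (INR (S n)) (INR (S (S n)))); lra.
- exact (is_lim_seq_inv_S 0).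
Qed.

(** The moduli [(n + 1) / (n + 2)] increase, yet consecutive ones differ by
    [1 / (n + 2) - 1 / (n + 3)], and this telescoping sum starts at 1/2, the modulus of the constant
    term. The lemma makes [L] locally invertible along [w]. *)
Lemma psum_dseq_logseq_neq_0 (z : C) : in_disk z -> psum (dseq logseq) z <> 0.
Proof.
assert (E : forall n, dseq logseq n =
    RtoC ((-1) ^ S n * (INR (S n) / INR (S (S n))))).
  intros n; unfold dseq, logseq; rewrite <- RtoC_mult; f_equal; field.
  apply Rgt_not_eq, INR_S_pos.
assert (E0 : dseq logseq O = RtoC (- / 2)) by (rewrite E; f_equal; simpl; field).
apply (psum_neq_0 _ (fun n => / INR (S (S n)))%R).
- exact (disk_seq_dseq _ disk_seq_logseq).
- rewrite E0; intros F; injection F; lra.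
- rewrite E0, Cmod_R, Rabs_Ropp, Rabs_right by lra; simpl; lra.
- intros n; rewrite !E, <- RtoC_plus.
  assert (H1 := INR_S_pos n).
  assert (H3 : (INR (S (S n)) = INR (S n) + 1)%R) by apply S_INR.
  assert (H4 : (INR (S (S (S n))) = INR (S n) + 2)%R) by (rewrite S_INR, H3; ring).
  replace ((-1) ^ S (S n) * (INR (S (S n)) / INR (S (S (S n)))) +
     (-1) ^ S n * (INR (S n) / INR (S (S n))))%R
    with ((-1) ^ n * (/ INR (S (S n)) - / INR (S (S (S n)))))%R
    by (rewrite H4, H3; simpl pow; field; lra).
  rewrite Cmod_alternating; [lra|].
  generalize (Rinv_le_contravar (INR (S (S n))) (INR (S (S (S n))))); lra.
- exact (is_lim_seq_inv_S 1).
Qed.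

(** Along a ray from 0, identities between complex functions reduce to comparing two pairs of real
    functions on [0, 1] with the same derivatives. *)
Lemma ray_derive (g : C -> C) (z l : C) (t : R) :
  @is_derive C_AbsRing C_NormedModule g (RtoC t * z) l ->
  is_derive (fun s : R => Re (g (RtoC s * z))) t (Re (z * l)) /\
  is_derive (fun s : R => Im (g (RtoC s * z))) t (Im (z * l)).
Proof.
intros H; assert (H' := proj1 (is_derive_near g _ l) H); clear H.
assert (K : forall e, (0 < e)%R -> exists d : posreal, forall h, h <> 0%R ->
   (Rabs h < d)%R ->
   (Cmod (g (RtoC (t + h) * z)%C - g (RtoC t * z)%C - RtoC h * (z * l)) < e * Rabs h)%R).
  intros e He; set (m := (Cmod z + 1)%R).
  assert (Hm : (0 < m)%R) by (generalize (Cmod_ge_0 z); unfold m; lra).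
  destruct (H' (e / m)%R) as [d [Hd Hn]]; [now apply Rdiv_lt_0_compat|].
  assert (Hdm : (0 < d / m)%R) by now apply Rdiv_lt_0_compat.
  exists (mkposreal _ Hdm); simpl; intros h Hh0 Hh.
  assert (Hh1 : (0 < Rabs h)%R) by now apply Rabs_pos_lt.
  assert (Eh : RtoC (t + h) * z - RtoC t * z = RtoC h * z).
    rewrite RtoC_plus; ring.
  assert (C1 : (Cmod (RtoC (t + h) * z - RtoC t * z) < Rabs h * m)%R).
    rewrite Eh, Cmod_mult, Cmod_R; unfold m; nra.
  specialize (Hn (RtoC (t + h) * z)).
  rewrite Eh in Hn, C1; rewrite (Cmult_assoc h z l).
  eapply Rle_lt_trans.
    apply Hn; eapply Rlt_trans; [exact C1|].
    apply Rmult_lt_compat_r with (r := m) in Hh; auto.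
    unfold Rdiv in Hh; rewrite Rmult_assoc, Rinv_l in Hh; lra.
  replace (e * Rabs h)%R with (e / m * (Rabs h * m))%R by (field; lra).
  apply Rmult_lt_compat_l; auto; now apply Rdiv_lt_0_compat.
assert (Q : forall a b c h e, h <> 0%R -> (Rabs (a - b - h * c) < e * Rabs h)%R ->
   (Rabs ((a - b) / h - c) < e)%R).
  intros a b c h e Hh HH; apply Rmult_lt_reg_r with (Rabs h); [now apply Rabs_pos_lt|].
  rewrite <- Rabs_mult.
  now replace (((a - b) / h - c) * h)%R with (a - b - h * c)%R by (field; auto).
split; apply is_derive_Reals; intros e He; destruct (K e He) as [d Hd];
  exists d; intros h Hh0 Hh; apply Q; auto; specialize (Hd h Hh0 Hh);
  (eapply Rle_lt_trans; [|exact Hd]).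
- eapply Rle_trans; [|apply re_le_Cmod]; right; f_equal.
  unfold Re; simpl; ring.
- eapply Rle_trans; [|apply Cmod_ge_Im]; right; f_equal.
  unfold Im; simpl; ring.
Qed.

Lemma real_eq_of_derive (f g df : R -> R) :
  (forall t, (0 <= t <= 1)%R -> is_derive f t (df t)) ->
  (forall t, (0 <= t <= 1)%R -> is_derive g t (df t)) ->
  f 0%R = g 0%R -> f 1%R = g 1%R.
Proof.
intros Hf Hg E0.
assert (E : (f 0 - g 0 = f 1 - g 1)%R).
  apply (eq_is_derive (V := R_NormedModule) (fun t => f t - g t)%R 0 1); [|lra].
  intros t Ht; generalize (is_derive_minus _ _ _ _ _ (Hf t Ht) (Hg t Ht)).
  intros H; replace (@zero R_NormedModule) with (minus (df t) (df t)); auto.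
  exact (Rplus_opp_r (df t)).
lra.
Qed.

Lemma in_disk_ray (z : C) (t : R) : in_disk z -> (0 <= t <= 1)%R -> in_disk (RtoC t * z).
Proof.
unfold in_disk; intros Hz Ht; rewrite Cmod_scal by lra.
generalize (Cmod_ge_0 z); nra.
Qed.

Lemma constant_on_disk (g : C -> C) :
  (forall z, in_disk z -> @is_derive C_AbsRing C_NormedModule g z (RtoC 0)) ->
  forall z, in_disk z -> g z = g 0.
Proof.
intros H z Hz.
assert (HRI : forall t, (0 <= t <= 1)%R -> _) by
  exact (fun t Ht => ray_derive g z 0 t (H _ (in_disk_ray z t Hz Ht))).
assert (E : forall c : C -> R, c 0 = 0%R ->
  (forall t, (0 <= t <= 1)%R -> is_derive (fun s : R => c (g (RtoC s * z))) t (c (z * 0))) ->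
  c (g z) = c (g 0)).
  intros c Hc HR.
  assert (F := real_eq_of_derive (fun _ => c (g 0)) (fun s : R => c (g (RtoC s * z)))
    (fun _ => 0%R)); simpl in F.
  replace (RtoC 0 * z) with (RtoC 0) in F by ring.
  replace (RtoC 1 * z) with z in F by ring.
  symmetry; apply F; auto.
  - intros t Ht; apply (is_derive_const (V := R_NormedModule)).
  - intros t Ht; generalize (HR t Ht); now replace (z * 0) with (RtoC 0) by ring; rewrite Hc.
apply injective_projections.
- apply (E Re); [reflexivity | intros t Ht; apply (HRI t Ht)].
- apply (E Im); [reflexivity | intros t Ht; apply (HRI t Ht)].
Qed.

Lemma psum_geometric (z : C) : in_disk z -> psum (fun n => RtoC ((-1) ^ n)) z = / (1 + z).
Proof.
intros Hz.
assert (Hd : disk_seq (fun n => RtoC ((-1) ^ n))).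
  apply disk_seq_bounded with 1%R; intros n; rewrite Cmod_R, pow_1_abs; lra.
assert (N : 1 + z <> 0).
  intros E; assert (F : z = -1) by (replace z with (1 + z - 1) by ring; rewrite E; ring).
  unfold in_disk in Hz; rewrite F, Cmod_R, Rabs_left in Hz; lra.
assert (E := psum_split _ z Hd Hz).
assert (E2 : psum (fun n => RtoC ((-1) ^ S n)) z = - psum (fun n => RtoC ((-1) ^ n)) z).
  apply has_sum_psum.
  generalize (has_sum_scal (-1) _ _ (psum_correct _ z Hd Hz)).
  replace (-1 * psum (fun n => RtoC ((-1) ^ n)) z)
    with (- psum (fun n => RtoC ((-1) ^ n)) z) by ring.
  apply has_sum_ext; intros n; simpl pow; rewrite RtoC_mult; ring.
cbv beta in E; rewrite E2 in E; set (s := psum (fun n => RtoC ((-1) ^ n)) z) in *.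
assert (G : s * (1 + z) = 1).
  simpl in E; replace (s * (1 + z)) with (s + z * s) by ring; rewrite E at 1; ring.
replace s with (s * (1 + z) * / (1 + z)) by (field; auto); rewrite G; ring.
Qed.

Definition shiftseq (a : nat -> C) (n : nat) : C :=
  match n with O => 0 | S m => a m end.

Lemma disk_seq_shiftseq (a : nat -> C) : disk_seq a -> disk_seq (shiftseq a).
Proof.
intros Ha r Hr; destruct (Ha r Hr) as [M HM]; exists (Rmax 0 M); intros [|n]; simpl.
  rewrite Cmod_0, Rmult_0_l; apply Rmax_l.
eapply Rle_trans; [|apply Rmax_r]; eapply Rle_trans; [|apply (HM n)].
apply Rmult_le_compat_l; [apply Cmod_ge_0|].
assert (0 <= r ^ n)%R by (apply pow_le; lra); nra.
Qed.

Lemma psum_shiftseq (a : nat -> C) (z : C) :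
  disk_seq a -> in_disk z -> psum (shiftseq a) z = z * psum a z.
Proof.
intros Ha Hz.
rewrite (psum_split _ z (disk_seq_shiftseq a Ha) Hz); simpl shiftseq.
change (fun n => a n) with a; ring.
Qed.

Lemma psum_ext (a b : nat -> C) (z : C) : (forall n, a n = b n) -> psum a z = psum b z.
Proof.
intros E; unfold psum; f_equal; apply Series_ext; intros n; now rewrite E.
Qed.

Lemma log_series_derive (z : C) :
  in_disk z ->
  @is_derive C_AbsRing C_NormedModule (psum (shiftseq logseq)) z (/ (1 + z)).
Proof.
intros Hz; rewrite <- psum_geometric by auto.
rewrite (psum_ext _ (dseq (shiftseq logseq))).
  now apply psum_derive; [apply disk_seq_shiftseq, disk_seq_logseq|].
intros n; unfold dseq, shiftseq, logseq; rewrite <- RtoC_mult; f_equal; field.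
apply Rgt_not_eq, INR_S_pos.
Qed.

Lemma ln_Cmod (x y : R) : (0 < x)%R -> ln (Cmod (x, y)) = (/ 2 * ln (x ^ 2 + y ^ 2))%R.
Proof.
intros Hx; unfold Cmod; simpl fst; simpl snd.
assert (H : (0 < x ^ 2 + y ^ 2)%R) by nra.
set (u := (x ^ 2 + y ^ 2)%R) in *.
rewrite <- (sqrt_def u) at 2 by lra.
rewrite ln_mult by now apply sqrt_lt_R0.
field.
Qed.

Lemma acos_right_half_plane (x y : R) :
  (0 < x)%R -> acos (x / Cmod (x, y)) = atan (Rabs y / x).
Proof.
intros Hx.
assert (Hn : (0 < x ^ 2 + y ^ 2)%R) by nra.
assert (Hm : (0 < Cmod (x, y))%R) by (unfold Cmod; simpl fst; simpl snd; now apply sqrt_lt_R0).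
assert (E : (Cmod (x, y) ^ 2 = x ^ 2 + y ^ 2)%R) by (rewrite Cmod2_alt; reflexivity).
set (m := Cmod (x, y)) in *.
rewrite acos_atan by now apply Rdiv_lt_0_compat.
f_equal.
replace (1 - (x / m)²)%R with ((Rabs y / m)²)%R.
  rewrite sqrt_Rsqr; [field; lra|].
  apply Rdiv_le_0_compat; [apply Rabs_pos | lra].
rewrite !Rsqr_div', <- Rsqr_abs; unfold Rsqr.
apply Rmult_eq_reg_r with (m ^ 2)%R; [|nra].
replace ((1 - x * x / (m * m)) * m ^ 2)%R with (m ^ 2 - x * x)%R by (field; lra).
rewrite E; unfold Rsqr; replace (y * y / (m * m) * (x ^ 2 + y ^ 2))%R
  with (y * y / (m * m) * m ^ 2)%R by now rewrite E.
field_simplify; lra.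
Qed.

Lemma Carg_right_half_plane (x y : R) : (0 < x)%R -> Carg (x, y) = atan (y / x).
Proof.
intros Hx; unfold Carg; change (Re (x, y)) with x; change (Im (x, y)) with y.
rewrite acos_right_half_plane by auto.
destruct (Rle_dec 0 y) as [Hy|Hy].
  now rewrite Rabs_right by lra.
rewrite Rabs_left by lra; rewrite <- atan_opp; f_equal; field; lra.
Qed.

(** For t in [0, 1] the point [1 + t z] stays in the right half-plane, so the argument is an
    arctangent. Both sides then vanish at t = 0 and have the derivative [z / (1 + t z)] in t. *)
Lemma Clog_series (z : C) : in_disk z -> Clog (1 + z) = z * psum logseq z.
Proof.
intros Hz; rewrite <- psum_shiftseq by (auto; apply disk_seq_logseq).
set (F := psum (shiftseq logseq)).
assert (HF : forall t, (0 <= t <= 1)%R -> _) by exact (fun t Ht =>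
  ray_derive F z _ t (log_series_derive _ (in_disk_ray z t Hz Ht))).
assert (F0 : F 0 = 0) by (apply psum_0, disk_seq_shiftseq, disk_seq_logseq).
destruct z as [x y].
assert (Hx : forall t, (0 <= t <= 1)%R -> (0 < 1 + t * x)%R).
  intros t Ht; assert (K := re_le_Cmod (x, y)); unfold in_disk in Hz.
  assert (K2 : (Rabs x < 1)%R) by exact (Rle_lt_trans _ _ _ K Hz).
  apply Rabs_lt_between in K2; nra.
assert (E1 : 1 + (x, y) = ((1 + x)%R, y)) by (unfold Cplus; simpl; f_equal; ring).
assert (H1 := Hx 1%R ltac:(lra)); rewrite Rmult_1_l in H1.
rewrite E1; unfold Clog.
rewrite ln_Cmod, Carg_right_half_plane by auto.
assert (I : forall t, (0 <= t <= 1)%R -> (0 < (1 + t * x) ^ 2 + (t * y) ^ 2)%R).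
  intros t Ht; specialize (Hx t Ht); nra.
assert (Z1 : RtoC 1 * (x, y) = (x, y)) by ring.
assert (Z0 : RtoC 0 * (x, y) = 0) by ring.
apply injective_projections; simpl fst; simpl snd.
- assert (G := real_eq_of_derive
    (fun t => / 2 * ln ((1 + t * x) ^ 2 + (t * y) ^ 2))%R
    (fun t => Re (F (RtoC t * (x, y))))
    (fun t => Re ((x, y) * / (1 + RtoC t * (x, y))))).
  cbv beta in G; rewrite Z1, Z0, F0, !Rmult_1_l, !Rmult_0_l in G.
  refine (G _ _ _); [ | intros t Ht; apply (HF t Ht) |].
  + intros t Ht; specialize (I t Ht); auto_derive; [simpl in I; lra|].
    unfold Re; simpl; field; intros K; lra.
  + replace ((1 + 0) ^ 2 + 0 ^ 2)%R with 1%R by ring.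
    rewrite ln_1; simpl; ring.
- assert (G := real_eq_of_derive
    (fun t => atan (t * y / (1 + t * x)))%R
    (fun t => Im (F (RtoC t * (x, y))))
    (fun t => Im ((x, y) * / (1 + RtoC t * (x, y))))).
  cbv beta in G; rewrite Z1, Z0, F0, !Rmult_1_l, !Rmult_0_l in G.
  refine (G _ _ _); [ | intros t Ht; apply (HF t Ht) |].
  + intros t Ht; specialize (I t Ht); specialize (Hx t Ht); auto_derive; [lra|].
    unfold Im; simpl; field; repeat split; intros K; lra.
  + replace (0 / (1 + 0))%R with 0%R by field; rewrite atan_0; reflexivity.
Qed.

Lemma Psi_series (z : C) : in_disk z -> Psi z = / psum logseq z.
Proof.
intros Hz; unfold Psi; destruct (Ceq_dec z 0) as [->|N].
- rewrite psum_0 by apply disk_seq_logseq; unfold logseq; simpl.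
  replace (1 / 1)%R with 1%R by field; field; intros E; injection E; lra.
- rewrite Clog_series by auto; field; split; auto; now apply psum_logseq_neq_0.
Qed.

(** * The upper bound *)

(** Bootstrapping: [T z - T z0 = (w z - w z0) * l1 (w z)], where [l1] takes the nonzero value of the
    derivative at [w z0]. So [T1 / (l1 o w)] is a quotient of [w], as smooth as [w] is known to be,
    and [w] gains one order. *)
Lemma analytic_implicit (l : nat -> C) (w T : C -> C) (z0 : C) :
  disk_seq l -> cont w z0 -> in_disk (w z0) -> psum (dseq l) (w z0) <> 0 ->
  analytic T z0 -> near z0 (fun z => psum l (w z) = T z) -> analytic w z0.
Proof.
intros Hl Hw Hw0 HN HT HE.
set (l1 := qseq l (w z0)).
assert (Hl1 : disk_seq l1) by now apply disk_seq_qseq.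
assert (N1 : psum l1 (w z0) <> 0) by (unfold l1; now rewrite psum_qseq_diag).
intros n; induction n as [|n IH]; [exact Hw|].
destruct (HT (S n)) as [T1 [A1 A2]].
assert (Hc : smooth n (fun z => psum l1 (w z)) z0).
  apply smooth_comp; auto; now apply psum_analytic.
exists (fun z => T1 z * / psum l1 (w z)); split.
  apply smooth_mult; auto; now apply smooth_inv.
generalize (near_and _ _ _ (near_and _ _ _ HE A2)
  (near_and _ _ _ (cont_neq _ _ _ (smooth_cont _ _ _ Hc) N1)
    (near_comp _ _ _ Hw (near_psum_quotient l _ Hl Hw0)))).
apply near_imp; intros z [[E1 E2] [E3 E4]].
fold l1 in E4; rewrite E1, (near_center _ _ HE), E2 in E4.
assert (F : (z - z0) * T1 z = (w z - w z0) * psum l1 (w z)).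
  replace ((z - z0) * T1 z) with (T z0 + (z - z0) * T1 z - T z0) by ring.
  rewrite E4; ring.
rewrite Cmult_assoc, F; field; auto.
Qed.

Definition jet (g : C -> C) (x0 x1 x2 x3 : C) : Prop :=
  exists r, cont r 0 /\
    near 0 (fun z => g z = x0 + z * (x1 + z * (x2 + z * (x3 + z * r z)))).

Lemma jet_ext (g h : C -> C) (x0 x1 x2 x3 : C) :
  near 0 (fun z => g z = h z) -> jet g x0 x1 x2 x3 -> jet h x0 x1 x2 x3.
Proof.
intros E [r [Hr H]]; exists r; split; auto.
generalize (near_and _ _ _ E H); apply near_imp; intros z [A B]; congruence.
Qed.

Lemma jet_eq (g : C -> C) (x0 x1 x2 x3 y0 y1 y2 y3 : C) :
  jet g x0 x1 x2 x3 -> x0 = y0 -> x1 = y1 -> x2 = y2 -> x3 = y3 -> jet g y0 y1 y2 y3.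
Proof. now intros H -> -> -> ->. Qed.

Lemma jet_const (c : C) : jet (fun _ => c) c 0 0 0.
Proof.
exists (fun _ => 0); split; [apply cont_const|]; apply near_all; intros; ring.
Qed.

Lemma jet_plus (g h : C -> C) (x0 x1 x2 x3 y0 y1 y2 y3 : C) :
  jet g x0 x1 x2 x3 -> jet h y0 y1 y2 y3 ->
  jet (fun z => g z + h z) (x0 + y0) (x1 + y1) (x2 + y2) (x3 + y3).
Proof.
intros [r [Hr A]] [s [Hs B]]; exists (fun z => r z + s z); split.
  now apply cont_plus.
generalize (near_and _ _ _ A B); apply near_imp; intros z [-> ->]; ring.
Qed.

Lemma jet_mult (g h : C -> C) (x0 x1 x2 x3 y0 y1 y2 y3 : C) :
  jet g x0 x1 x2 x3 -> jet h y0 y1 y2 y3 ->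
  jet (fun z => g z * h z) (x0 * y0) (x0 * y1 + x1 * y0)
    (x0 * y2 + x1 * y1 + x2 * y0) (x0 * y3 + x1 * y2 + x2 * y1 + x3 * y0).
Proof.
intros [r [Hr A]] [s [Hs B]].
(* The terms of order at least four in the product of the two expansions, divided by [z^4]. *)
exists (fun z => x1 * y3 + x2 * y2 + x3 * y1 + z * (x2 * y3 + x3 * y2 + z * (x3 * y3))
  + r z * (y0 + z * (y1 + z * (y2 + z * (y3 + z * s z))))
  + (x0 + z * (x1 + z * (x2 + z * x3))) * s z).
split.
- repeat first [assumption | apply cont_const | apply cont_id
    | apply cont_plus | apply cont_mult].
- generalize (near_and _ _ _ A B); apply near_imp; intros z [-> ->]; ring.
Qed.

(** Constant terms agree by continuity at 0, after which z is cancelled. Cancellation is valid only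
    off 0, hence the punctured equality in both hypothesis and conclusion. *)
Lemma jet_step (x y : C) (r s : C -> C) :
  cont r 0 -> cont s 0 -> near 0 (fun z => z <> 0 -> x + z * r z = y + z * s z) ->
  x = y /\ near 0 (fun z => z <> 0 -> r z = s z).
Proof.
intros Hr Hs H.
assert (E : x = y).
  assert (F := cont_unique (fun z => x + z * r z) (fun z => y + z * s z) 0).
  cbv beta in F; replace (x + 0 * r 0) with x in F by ring.
  replace (y + 0 * s 0) with y in F by ring.
  apply F; auto; (apply cont_plus; [apply cont_const|]; apply cont_mult; auto; apply cont_id).
split; auto; revert H; apply near_imp; intros z Hz N; specialize (Hz N); subst y.
assert (G : z * r z = z * s z).
  replace (z * r z) with (x + z * r z - x) by ring; rewrite Hz; ring.
replace (r z) with (z * r z * / z) by (field; auto); rewrite G; field; auto.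
Qed.

Lemma jet_unique (g : C -> C) (x0 x1 x2 x3 y0 y1 y2 y3 : C) :
  jet g x0 x1 x2 x3 -> jet g y0 y1 y2 y3 ->
  x0 = y0 /\ x1 = y1 /\ x2 = y2 /\ x3 = y3.
Proof.
intros [r [Hr A]] [s [Hs B]].
assert (Hc : forall (x : C) (t : C -> C), cont t 0 -> cont (fun z => x + z * t z) 0).
  intros x t Ht; apply cont_plus; [apply cont_const|]; apply cont_mult; auto; apply cont_id.
assert (H : near 0 (fun z => z <> 0 ->
    x0 + z * (x1 + z * (x2 + z * (x3 + z * r z))) =
    y0 + z * (y1 + z * (y2 + z * (y3 + z * s z))))).
  generalize (near_and _ _ _ A B); apply near_imp; intros z [E F] _; congruence.
apply jet_step in H as [E0 H]; [|repeat apply Hc; auto|repeat apply Hc; auto].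
apply jet_step in H as [E1 H]; [|repeat apply Hc; auto|repeat apply Hc; auto].
apply jet_step in H as [E2 H]; [|repeat apply Hc; auto|repeat apply Hc; auto].
apply jet_step in H as [E3 H]; auto.
Qed.

Lemma jet_smooth (g : C -> C) : smooth 4 g 0 -> exists x1 x2 x3, jet g (g 0) x1 x2 x3.
Proof.
intros [g1 [[g2 [[g3 [[r [Hr E3]] E2]] E1]] E0]].
exists (g1 0), (g2 0), (g3 0), r; split; auto.
generalize (near_and _ _ _ (near_and _ _ _ E0 E1) (near_and _ _ _ E2 E3)); apply near_imp.
intros z [[-> ->] [-> ->]]; ring.
Qed.

Lemma jet_psum (a : nat -> C) :
  disk_seq a -> jet (psum a) (a 0%nat) (a 1%nat) (a 2%nat) (a 3%nat).
Proof.
intros Ha; exists (psum (fun n => a (4 + n)%nat)); split.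
  apply psum_cont; [now apply disk_seq_add | apply in_disk_0].
generalize (near_disk 0 in_disk_0); apply near_imp; intros z Hz.
rewrite (psum_split a), (psum_split (fun n => a (S n))),
  (psum_split (fun n => a (S (S n)))), (psum_split (fun n => a (S (S (S n)))));
  auto; [exact (disk_seq_add a 3 Ha) | exact (disk_seq_add a 2 Ha) | exact (disk_seq_add a 1 Ha)].
Qed.

Lemma jet_log_comp (w : C -> C) (c1 c2 c3 : C) :
  analytic w 0 -> w 0 = 0 -> jet w 0 c1 c2 c3 ->
  jet (fun z => psum logseq (w z)) 1 (- (c1 / 2)) (- (c2 / 2) + c1 ^ 2 / 3)
    (- (c3 / 2) + 2 * c1 * c2 / 3 - c1 ^ 3 / 4).
Proof.
intros Hw Hw0 Jw.
assert (HL := disk_seq_logseq).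
assert (HL3 := disk_seq_add _ 3 HL).
assert (Hd0 : in_disk (w 0)) by (rewrite Hw0; apply in_disk_0).
(* The tail of [L(w)] after [w^2] carries a factor [w^3], and [w] vanishes at 0. So only its value
   at 0, the coefficient -1/4, matters; [s1], [s2], [s3] drop out. *)
destruct (jet_smooth (fun z => psum (fun n => logseq (3 + n)%nat) (w z))) as [s1 [s2 [s3 Js]]].
  apply smooth_comp; [apply Hw | now apply psum_analytic].
rewrite Hw0, psum_0 in Js by auto.
assert (J := jet_plus _ _ _ _ _ _ _ _ _ _ (jet_const (logseq 0)) (jet_mult _ _ _ _ _ _ _ _ _ _ Jw
  (jet_plus _ _ _ _ _ _ _ _ _ _ (jet_const (logseq 1)) (jet_mult _ _ _ _ _ _ _ _ _ _ Jw
  (jet_plus _ _ _ _ _ _ _ _ _ _ (jet_const (logseq 2)) (jet_mult _ _ _ _ _ _ _ _ _ _ Jw Js)))))).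
assert (E0 : logseq 0 = 1) by (unfold logseq; simpl; f_equal; field).
assert (E1 : logseq 1 = - (1 / 2)).
  unfold logseq; simpl; rewrite <- RtoC_div, <- RtoC_opp; [f_equal; field | lra].
assert (E2 : logseq 2 = 1 / 3).
  unfold logseq; simpl; rewrite <- RtoC_div; [f_equal; field | lra].
assert (E3 : logseq 3 = - (1 / 4)).
  unfold logseq; simpl; rewrite <- RtoC_div, <- RtoC_opp; [f_equal; field | lra].
change (logseq (3 + 0)) with (logseq 3) in J; rewrite E0, E1, E2, E3 in J.
eapply jet_ext; [|refine (jet_eq _ _ _ _ _ _ _ _ _ J _ _ _ _); unfold Cdiv; ring].
generalize (near_comp _ _ _ (smooth_cont 0 _ _ (Hw 0%nat)) (near_disk _ Hd0)).
apply near_imp; intros z Hz.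
rewrite (psum_split logseq), (psum_split (fun n => logseq (S n))),
  (psum_split (fun n => logseq (S (S n)))), E0, E1, E2; auto;
  [exact (disk_seq_add _ 2 HL) | exact (disk_seq_add _ 1 HL)].
Qed.

Lemma C_derive_expansion (f : C -> C) (a : nat -> C) (z : C) :
  power_expansion f a -> in_disk z -> C_derive f z = psum (dseq a) z.
Proof.
intros H Hz; assert (Ha := disk_seq_of_expansion f a H).
apply is_C_derive_unique, is_derive_near.
assert (K := proj1 (is_derive_near _ _ _) (psum_derive a z Ha Hz)).
intros e He; generalize (near_and _ _ _ (near_disk z Hz) (K e He)).
apply near_imp; intros y [Hy Q].
now rewrite !(expansion_psum f a) in Q.
Qed.

(** Here [1, m1, m2, m3] are the coefficients of [L(w)], and the hypotheses compare those of z, z^2,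
    z^3 in [L(w) f' = f / z]. The system is triangular in [a2, a3, a4]. *)
Lemma coefficient_identity (a2 a3 a4 c1 c2 c3 : C) :
  let m1 := - (c1 / 2) in let m2 := - (c2 / 2) + c1 ^ 2 / 3 in
  let m3 := - (c3 / 2) + 2 * c1 * c2 / 3 - c1 ^ 3 / 4 in
  2 * a2 + m1 = a2 -> 3 * a3 + 2 * a2 * m1 + m2 = a3 ->
  4 * a4 + 3 * a3 * m1 + 2 * a2 * m2 + m3 = a4 ->
  a2 * a3 - a4 = - (cubic c1 c2 c3 / 6).
Proof.
intros m1 m2 m3 E2 E3 E4.
assert (F2 : a2 = - m1) by (replace a2 with (2 * a2 + m1 - a2 - m1) by ring; rewrite E2; ring).
assert (F3 : a3 = - (2 * a2 * m1 + m2) / 2).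
  replace a3 with ((3 * a3 + 2 * a2 * m1 + m2 - a3 - (2 * a2 * m1 + m2)) / 2) by field.
  rewrite E3; field.
assert (F4 : a4 = - (3 * a3 * m1 + 2 * a2 * m2 + m3) / 3).
  replace a4 with ((4 * a4 + 3 * a3 * m1 + 2 * a2 * m2 + m3 - a4
    - (3 * a3 * m1 + 2 * a2 * m2 + m3)) / 3) by field.
  rewrite E4; field.
rewrite F4, F3, F2; unfold m1, m2, m3, cubic; field.
Qed.

Lemma upper_bound (f : C -> C) (a : nat -> C) :
  class_SG f -> power_expansion f a ->
  (Cmod (a 2%nat * a 3%nat - a 4%nat) <= 1 / 6)%R.
Proof.
intros [[_ [f0 f1]] [fN [w [Hw [w0 [wD wE]]]]]] Hf.
assert (Ha := disk_seq_of_expansion f a Hf).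
assert (Hda := disk_seq_dseq a Ha); assert (Hsa := disk_seq_shift a Ha).
assert (a0 : a 0%nat = 0).
  now rewrite <- (psum_0 a Ha), (expansion_psum f a 0 Hf in_disk_0).
assert (a1 : a 1%nat = 1).
  rewrite (C_derive_expansion f a 0 Hf in_disk_0), psum_0 in f1 by auto.
  unfold dseq in f1; simpl in f1; rewrite <- f1; ring.
set (e := psum (fun n => a (S n))).
assert (Ef : forall z, in_disk z -> f z = z * e z).
  intros z Hz; rewrite <- (expansion_psum f a z Hf Hz), (psum_split a z Ha Hz), a0.
  unfold e; ring.
assert (e0 : e 0 = 1) by (unfold e; now rewrite psum_0).
assert (eN : forall z, in_disk z -> e z <> 0).
  intros z Hz; destruct (Ceq_dec z 0) as [->|N].
    rewrite e0; intros F; injection F; lra.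
  intros F; apply (fN z Hz N); rewrite (Ef z Hz), F; ring.
set (f' := psum (dseq a)).
assert (f'0 : f' 0 = 1).
  unfold f'; now rewrite <- (C_derive_expansion f a 0 Hf in_disk_0).
(* The subordination with all divisions cleared; in this form it also holds at 0 and shows that [f']
   has no zero. *)
assert (EL : forall z, in_disk z -> psum logseq (w z) * f' z = e z).
  intros z Hz; destruct (Ceq_dec z 0) as [->|N].
    rewrite w0, f'0, e0, (psum_0 _ disk_seq_logseq); unfold logseq; simpl.
    replace (1 / 1)%R with 1%R by field; ring.
  assert (W := wE z Hz); unfold starlike_quotient in W.
  destruct (Ceq_dec z 0) as [F|_]; [elim (N F)|].
  rewrite (C_derive_expansion f a z Hf Hz), (Psi_series _ (wD z Hz)), (Ef z Hz) in W.
  fold f' in W; assert (LN := psum_logseq_neq_0 _ (wD z Hz)); assert (EN := eN z Hz).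
  replace (f' z) with (z * f' z / (z * e z) * e z) by (field; auto).
  rewrite W; field; auto.
assert (f'N : forall z, in_disk z -> f' z <> 0).
  intros z Hz F; apply (eN z Hz); rewrite <- (EL z Hz), F; ring.
assert (wA : disk_analytic w).
  intros z Hz; apply (analytic_implicit logseq w (fun z => e z * / f' z)).
  - apply disk_seq_logseq.
  - now apply ex_derive_cont, Hw.
  - now apply wD.
  - now apply psum_dseq_logseq_neq_0, wD.
  - intros n; apply smooth_mult; [|apply smooth_inv; auto]; now apply psum_analytic.
  - generalize (near_disk z Hz); apply near_imp; intros y Hy.
    rewrite <- (EL y Hy); field; auto.
destruct (disk_division w wA) as [phi [Aphi Ephi]].
destruct (disk_division phi Aphi) as [psi [Apsi Epsi]].
destruct (disk_division psi Apsi) as [chi [Achi Echi]].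
(* The fourth division only provides the continuous remainder of the jet of [w]. *)
destruct (disk_division chi Achi) as [th [Ath Eth]].
assert (B : (Cmod (cubic (phi 0) (psi 0) (chi 0)) <= 1)%R).
  apply cubic_bound; auto; apply schwarz; auto; intros z Hz; left.
  replace (z * phi z) with (w z) by (rewrite Ephi, w0; ring); now apply wD.
assert (Jw : jet w 0 (phi 0) (psi 0) (chi 0)).
  exists th; split; [apply (smooth_cont 0), (Ath 0 in_disk_0 0%nat)|].
  apply near_all; intros z; now rewrite <- Eth, <- Echi, <- Epsi, <- w0.
assert (J := jet_mult _ _ _ _ _ _ _ _ _ _
  (jet_log_comp w _ _ _ (wA 0 in_disk_0) w0 Jw) (jet_psum _ Hda)).
apply (jet_ext _ e) in J;
  [|generalize (near_disk 0 in_disk_0); apply near_imp; exact EL].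
destruct (jet_unique _ _ _ _ _ _ _ _ _ J (jet_psum _ Hsa)) as [_ [K1 [K2 K3]]].
unfold dseq in K1, K2, K3; simpl in K1, K2, K3; rewrite a1 in K1, K2, K3.
rewrite (coefficient_identity _ _ _ (phi 0) (psi 0) (chi 0)).
- unfold Cdiv; rewrite Cmod_opp, Cmod_mult, Cmod_inv_6; lra.
- rewrite <- K1 at 2; rewrite !RtoC_plus; unfold Cdiv; ring.
- rewrite <- K2 at 2; rewrite !RtoC_plus; unfold Cdiv; ring.
- rewrite <- K3 at 2; rewrite !RtoC_plus; unfold Cdiv; ring.
Qed.

(** * The extremal function *)

(** The recursion refers to all earlier values, so it is run with fuel: stage [m] is correct up to
    index [m], and the diagonal is the sequence sought. *)
Lemma recursive_sequence (q : nat -> nat -> R) :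
  exists x : nat -> R, x O = 1%R /\
    forall n, x (S n) = sum_n (fun k => (q n k * x k)%R) n.
Proof.
set (u := fix u (m : nat) : nat -> R :=
  match m with
  | O => fun _ => 1%R
  | S m' => fun n => match n with
            | O => 1%R
            | S n' => sum_n (fun k => (q n' k * u m' k)%R) n'
            end
  end).
assert (H : forall m n, (n <= m)%nat -> u (S m) n = u m n).
  intros m; induction m as [|m IH]; intros [|n] Hn; [reflexivity | lia | reflexivity |].
  simpl; apply sum_n_ext_loc; intros k Hk; f_equal; apply (IH k); lia.
assert (H' : forall n k, (k <= n)%nat -> u n k = u k k).
  intros n k Hk; induction Hk as [|n Hk IH]; auto; rewrite <- IH; now apply H.
exists (fun n => u n n); split; [reflexivity|].
intros n; simpl; apply sum_n_ext_loc; intros k Hk; now rewrite H'.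
Qed.

Lemma sum_n_le_head (t : nat -> R) (n : nat) :
  (forall k, (1 <= k <= n)%nat -> (t k <= 0)%R) -> (sum_n t n <= t O)%R.
Proof.
induction n as [|n IH]; intros H; [rewrite sum_O; lra|].
rewrite sum_Sn; unfold plus; simpl.
assert (A : (sum_n t n <= t O)%R) by (apply IH; intros k Hk; apply H; lia).
assert (B : (t (S n) <= 0)%R) by (apply H; lia).
lra.
Qed.

Lemma sum_n_le_loc (s t : nat -> R) (n : nat) :
  (forall k, (k <= n)%nat -> (s k <= t k)%R) -> (sum_n s n <= sum_n t n)%R.
Proof.
induction n as [|n IH]; intros H; [rewrite !sum_O; now apply H|].
rewrite !sum_Sn; unfold plus; simpl.
apply Rplus_le_compat; [apply IH; intros k Hk; apply H; lia | now apply H].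
Qed.

(* Kaluza's theorem: by log-convexity [l (n + 1 - k) <= (l (n + 1) / l n) * l (n - k)],
   so the sum defining [g (n + 1)] is compared with the vanishing one for [g n]. *)
Lemma reciprocal_bounds (l g : nat -> R) :
  l O = 1%R -> (forall n, (0 < l n)%R) ->
  (forall n k, (k <= n)%nat -> (l (S k) * l n <= l (S n) * l k)%R) ->
  g O = 1%R -> (forall n, g (S n) = - sum_n (fun k => l (S n - k)%nat * g k) n)%R ->
  forall n, (- l (S n) <= g (S n) <= 0)%R.
Proof.
intros l0 lpos lconv g0 grec.
assert (I : forall n, sum_n (fun k => l (S n - k)%nat * g k)%R (S n) = 0%R).
  intros n; rewrite sum_Sn, Nat.sub_diag, l0, grec; unfold plus; simpl; ring.
assert (J : forall n m, (m <= n)%nat -> (- l (S m) <= g (S m) <= 0)%R);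
  [|intros n; now apply (J n)].
assert (Hstep : forall n, (forall k, (1 <= k <= n)%nat -> (g k <= 0)%R) ->
    (- l (S n) <= g (S n) <= 0)%R).
  intros n Hn; rewrite grec; split.
  - apply Ropp_le_contravar.
    eapply Rle_trans; [apply sum_n_le_head|].
      intros k Hk; generalize (lpos (S n - k)%nat) (Hn k Hk); nra.
    simpl; rewrite g0; lra.
  - rewrite <- Ropp_0; apply Ropp_le_contravar.
    destruct n as [|n].
      rewrite sum_O, g0; generalize (lpos 1%nat); simpl; lra.
    apply Rmult_le_reg_l with (l (S n)); [apply lpos|].
    rewrite Rmult_0_r, <- (Rmult_0_r (l (S (S n)))), <- (I n).
    rewrite <- !(sum_n_mult_l (K := R_Ring)).
    apply sum_n_le_loc; intros k Hk.
    change (l (S (S n)) * (l (S n - k)%nat * g k) <= l (S n) * (l (S (S n) - k)%nat * g k))%R.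
    destruct k as [|k].
      simpl; rewrite g0; right; ring.
    assert (Hg := Hn (S k) ltac:(lia)).
    replace (S (S n) - S k)%nat with (S (n - k)) by lia.
    replace (S n - S k)%nat with (n - k)%nat by lia.
    generalize (Rmult_le_compat_neg_l _ _ _ Hg (lconv (S n) (n - k)%nat ltac:(lia))).
    lra.
intros n; induction n as [|n IH]; intros m Hm.
  replace m with O by lia; apply Hstep; intros; lia.
destruct (Nat.eq_dec m (S n)) as [->|]; [|apply IH; lia].
apply Hstep; intros [|k] Hk; [lia|]; apply IH; lia.
Qed.

Lemma sum_n_RtoC (x : nat -> R) (n : nat) :
  @sum_n C_AbelianMonoid (fun k => RtoC (x k)) n = RtoC (sum_n x n).
Proof.
induction n as [|n IH]; [now rewrite !sum_O|].
rewrite !sum_Sn, IH; symmetry; apply RtoC_plus.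
Qed.

Lemma psum_zero (z : C) : in_disk z -> psum (fun _ => 0) z = 0.
Proof.
intros Hz; apply has_sum_psum.
generalize (has_sum_scal 0 _ _ (psum_correct logseq z disk_seq_logseq Hz)).
rewrite Cmult_0_l; apply has_sum_ext; intros n; ring.
Qed.

Lemma psum_one (c : nat -> C) (z : C) :
  c O = 1 -> (forall n, c (S n) = 0) -> in_disk z -> psum c z = 1.
Proof.
intros H0 HS Hz; rewrite (psum_split c z), H0; auto.
- rewrite (psum_ext _ (fun _ => 0) z HS), psum_zero by auto; ring.
- apply disk_seq_bounded with 1%R; intros [|n]; [rewrite H0, Cmod_1 | rewrite HS, Cmod_0]; lra.
Qed.

Lemma gregory_coefficients :
  exists G : nat -> R, G O = 1%R /\ G 1%nat = (1 / 2)%R /\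
    (forall n, (Rabs (G n) <= 1)%R) /\
    forall z, in_disk z -> Psi z = psum (fun n => RtoC (G n)) z.
Proof.
set (l := fun n => (/ INR (S n))%R).
destruct (recursive_sequence (fun n k => - l (S n - k)%nat)%R) as [g [g0 g1]].
assert (lpos : forall n, (0 < l n)%R).
  intros n; apply Rinv_0_lt_compat, INR_S_pos.
assert (l0 : l O = 1%R) by (unfold l; simpl; field).
assert (grec : forall n, g (S n) = (- sum_n (fun k => l (S n - k)%nat * g k) n)%R).
  intros n; rewrite g1.
  replace (- sum_n (fun k => l (S n - k)%nat * g k) n)%R
    with (-1 * sum_n (fun k => l (S n - k)%nat * g k) n)%R by ring.
  refine (eq_trans _ (sum_n_mult_l (K := R_Ring) (-1)%R _ n)).
  apply sum_n_ext; intros k; unfold mult; simpl; ring.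
assert (B := reciprocal_bounds l g l0 lpos).
assert (HB : forall n, (- l (S n) <= g (S n) <= 0)%R).
  apply B; auto; intros n k Hk; unfold l; rewrite <- !Rinv_mult.
  assert (H1 := INR_S_pos n); assert (H2 := INR_S_pos k).
  apply Rinv_le_contravar.
    apply Rmult_lt_0_compat; [apply INR_S_pos | auto].
  rewrite (S_INR (S n)), (S_INR (S k)).
  assert (INR (S k) <= INR (S n))%R by (apply le_INR; lia); nra.
(* [g] is the reciprocal sequence of [1 / (n + 1)]; replacing z by -z turns it into that of [L]. *)
exists (fun n => (-1) ^ n * g n)%R; split; [rewrite g0; simpl; ring|].
split; [|split].
- rewrite grec, sum_O, g0; unfold l; simpl; field.
- intros n; rewrite Rabs_mult, pow_1_abs, Rmult_1_l.
  destruct n as [|n]; [rewrite g0, Rabs_R1; lra|].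
  apply Rabs_le; assert (l (S n) <= 1)%R; [|generalize (HB n); lra].
  unfold l; rewrite <- Rinv_1; apply Rinv_le_contravar; [lra|].
  rewrite S_INR; generalize (pos_INR (S n)); lra.
- intros z Hz; rewrite Psi_series by auto.
  set (G := fun n => RtoC ((-1) ^ n * g n)).
  assert (HG : disk_seq G).
    apply disk_seq_bounded with 1%R; intros n; unfold G.
    rewrite Cmod_R, Rabs_mult, pow_1_abs, Rmult_1_l.
    destruct n as [|n]; [rewrite g0, Rabs_R1; lra|].
    apply Rabs_le; assert (l (S n) <= 1)%R; [|generalize (HB n); lra].
    unfold l; rewrite <- Rinv_1; apply Rinv_le_contravar; [lra|].
    rewrite S_INR; generalize (pos_INR (S n)); lra.
  assert (E : forall n, conv G logseq n =
      RtoC ((-1) ^ n * sum_n (fun k => l (n - k)%nat * g k)%R n)).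
    intros n; unfold conv.
    rewrite <- (sum_n_mult_l (K := R_Ring) ((-1) ^ n)%R).
    rewrite <- sum_n_RtoC; apply sum_n_ext_loc; intros k Hk.
    unfold G, logseq, l; change (RtoC ((-1) ^ k * g k) * RtoC ((-1) ^ (n - k) / INR (S (n - k)))
      = RtoC ((-1) ^ n * (/ INR (S (n - k)) * g k))).
    rewrite <- RtoC_mult; f_equal.
    replace ((-1) ^ n)%R with ((-1) ^ k * (-1) ^ (n - k))%R
      by (rewrite <- pow_add; f_equal; lia).
    unfold Rdiv; ring.
  assert (P : psum G z * psum logseq z = 1).
    rewrite <- psum_mult by (auto; apply disk_seq_logseq).
    apply psum_one; auto.
    + rewrite E, sum_O, Nat.sub_diag, l0, g0; f_equal; simpl; ring.
    + intros n; rewrite E; f_equal.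
      rewrite sum_Sn, Nat.sub_diag, l0, grec; unfold plus; simpl; ring.
  assert (N := psum_logseq_neq_0 z Hz).
  replace (psum G z) with (psum G z * psum logseq z * / psum logseq z) by (field; auto).
  rewrite P; ring.
Qed.

(** Used to substitute [z^3] into a power series: the n-th partial sum of the spread-out series is
    the [(n / 3)]-th of the original. *)
Lemma has_sum_sparse (u : nat -> C) (l : C) :
  has_sum u l ->
  has_sum (fun k => if Nat.eqb (k mod 3) 0 then u (k / 3)%nat else 0) l.
Proof.
set (v := fun k => if Nat.eqb (k mod 3) 0 then u (k / 3)%nat else 0).
assert (E : forall n, @sum_n C_AbelianMonoid v n = @sum_n C_AbelianMonoid u (n / 3)%nat).
  intros n; induction n as [|n IH]; [now rewrite !sum_O|].
  rewrite sum_Sn, IH; unfold v.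
  assert (D1 := Nat.div_mod_eq n 3); assert (D2 := Nat.div_mod_eq (S n) 3).
  assert (B1 := Nat.mod_upper_bound n 3 ltac:(lia)).
  assert (B2 := Nat.mod_upper_bound (S n) 3 ltac:(lia)).
  destruct (Nat.eqb_spec (S n mod 3) 0) as [Z|Z].
  - replace (S n / 3)%nat with (S (n / 3)) by lia; now rewrite sum_Sn.
  - replace (S n / 3)%nat with (n / 3)%nat by lia.
    exact (plus_zero_r (G := C_AbelianMonoid) _).
unfold has_sum, is_series; intros H.
apply (filterlim_ext (fun n => @sum_n C_AbelianMonoid u (n / 3)%nat)); [now intros n; rewrite E|].
refine (filterlim_comp _ _ _ (fun n => (n / 3)%nat) _ _ eventually _ _ H).
intros P [N HN]; exists (3 * N)%nat; intros n Hn; apply HN.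
assert (D1 := Nat.div_mod_eq n 3).
assert (B1 := Nat.mod_upper_bound n 3 ltac:(lia)); lia.
Qed.

(** The power series solution of [x' = q x], [x(0) = 1]. The coefficient [x (S n)] is an average of
    [n + 1] products of numbers at most 1 in modulus, so the bound 1 reproduces itself. *)
Lemma linear_ode_series (q : nat -> R) :
  (forall n, (Rabs (q n) <= 1)%R) ->
  exists x : nat -> R, x O = 1%R /\
    (forall n, x (S n) = / INR (S n) * sum_n (fun k => q (n - k)%nat * x k) n)%R /\
    disk_seq (fun n => RtoC (x n)) /\
    forall z, in_disk z ->
      psum (dseq (fun n => RtoC (x n))) z =
      psum (fun n => RtoC (x n)) z * psum (fun n => RtoC (q n)) z.
Proof.
intros Hq.
destruct (recursive_sequence (fun n k => / INR (S n) * q (n - k)%nat)%R) as [x [x0 x1]].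
assert (xrec : forall n, x (S n) = (/ INR (S n) * sum_n (fun k => q (n - k)%nat * x k) n)%R).
  intros n; rewrite x1; refine (eq_trans _ (sum_n_mult_l (K := R_Ring) _ _ n)).
  apply sum_n_ext; intros k; unfold mult; simpl; ring.
assert (B : forall n m, (m <= n)%nat -> (Rabs (x m) <= 1)%R).
  intros n; induction n as [|n IH]; intros m Hm.
    replace m with O by lia; rewrite x0, Rabs_R1; lra.
  destruct (Nat.eq_dec m (S n)) as [->|]; [|apply IH; lia].
  assert (P := INR_S_pos n).
  rewrite xrec, Rabs_mult, Rabs_right by (apply Rle_ge, Rlt_le, Rinv_0_lt_compat, P).
  apply Rmult_le_reg_l with (INR (S n)); auto.
  rewrite <- Rmult_assoc, Rinv_r, Rmult_1_l, Rmult_1_r by lra.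
  assert (K : forall N (t : nat -> R), (forall k, (k <= N)%nat -> (Rabs (t k) <= 1)%R) ->
            (Rabs (sum_n t N) <= INR (S N))%R).
    intros N t; induction N as [|N IHN]; intros Ht.
      rewrite sum_O; simpl; apply (Ht O); lia.
    rewrite sum_Sn, S_INR; eapply Rle_trans; [apply Rabs_triang|].
    apply Rplus_le_compat; [apply IHN; intros; apply Ht; lia | apply Ht; lia].
  apply K; intros k Hk; rewrite Rabs_mult.
  generalize (Hq (n - k)%nat) (IH k Hk) (Rabs_pos (q (n - k)%nat)) (Rabs_pos (x k)); nra.
assert (Hx : disk_seq (fun n => RtoC (x n))).
  apply disk_seq_bounded with 1%R; intros n; rewrite Cmod_R; now apply (B n).
exists x; split; [|split; [|split]]; auto.
intros z Hz; rewrite <- psum_mult; auto.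
- apply psum_ext; intros n; unfold dseq, conv.
  rewrite (sum_n_ext _ (fun k => RtoC (q (n - k)%nat * x k))).
    rewrite sum_n_RtoC, xrec, <- RtoC_mult; f_equal; field.
    apply Rgt_not_eq, INR_S_pos.
  intros k; rewrite RtoC_mult; apply Cmult_comm.
- apply disk_seq_bounded with 1%R; intros n; now rewrite Cmod_R.
Qed.

Lemma smooth_ex_derive (g : C -> C) (z : C) :
  smooth 1 g z -> @ex_derive C_AbsRing C_NormedModule g z.
Proof. intros [g1 [H1 H2]]; exists (g1 z); now apply is_derive_quotient. Qed.

Lemma psum_mult_derive (a b : nat -> C) (z : C) :
  disk_seq a -> disk_seq b -> in_disk z ->
  @is_derive C_AbsRing C_NormedModule (fun y => psum a y * psum b y) z
    (psum (dseq a) z * psum b z + psum a z * psum (dseq b) z).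
Proof.
intros Ha Hb Hz.
rewrite <- !psum_qseq_diag by auto.
apply (is_derive_quotient _ (fun y => psum (qseq a z) y * psum b y + psum a z * psum (qseq b z) y)).
- assert (Ka := psum_cont _ z (disk_seq_qseq a z Ha Hz) Hz).
  assert (Kb := psum_cont _ z (disk_seq_qseq b z Hb Hz) Hz).
  assert (Kc := psum_cont _ z Hb Hz).
  apply cont_plus; apply cont_mult; auto; apply cont_const.
- generalize (near_and _ _ _ (near_psum_quotient a z Ha Hz) (near_psum_quotient b z Hb Hz)).
  apply near_imp; intros y [-> ->]; ring.
Qed.

Lemma extremal_function :
  exists (f : C -> C) (a : nat -> C),
    class_SG f /\ power_expansion f a /\
    Cmod (a 2%nat * a 3%nat - a 4%nat) = (1 / 6)%R.
Proof.
destruct gregory_coefficients as [G [G0 [G1 [GB GE]]]].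
set (p := fun k => if Nat.eqb (k mod 3) 0 then G (k / 3)%nat else 0%R).
assert (pB : forall k, (Rabs (p k) <= 1)%R).
  intros k; unfold p; destruct (Nat.eqb _ _); auto; rewrite Rabs_R0; lra.
(* With [f = z X], [z f' / f = 1 + z X' / X]. Since [Psi(z^3) = 1 + z Q(z)], the equation to solve
   is [X' = X Q]. *)
set (q := fun k => p (S k)).
assert (qB : forall k, (Rabs (q k) <= 1)%R) by (intros k; apply pB).
destruct (linear_ode_series q qB) as [x [x0 [xrec [Hx xE]]]].
destruct (linear_ode_series (fun n => - q n)%R) as [y [y0 [_ [Hy yE]]]].
  intros n; rewrite Rabs_Ropp; apply qB.
set (X := fun n => RtoC (x n)) in *; set (Y := fun n => RtoC (y n)) in *.
set (Q := fun n => RtoC (q n)) in *; set (P := fun n => RtoC (p n)).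
assert (HP : disk_seq P).
  apply disk_seq_bounded with 1%R; intros n; unfold P; now rewrite Cmod_R.
assert (HQ : disk_seq Q) by exact (disk_seq_shift P HP).
assert (HGs : disk_seq (fun n => RtoC (G n))).
  apply disk_seq_bounded with 1%R; intros n; now rewrite Cmod_R.
assert (Hcube : forall z, in_disk z -> in_disk (z * z * z)).
  unfold in_disk; intros z Hz; rewrite !Cmod_mult; generalize (Cmod_ge_0 z); intros.
  assert (Cmod z * Cmod z < 1)%R by nra; nra.
assert (PE : forall z, in_disk z -> psum P z = Psi (z * z * z)).
  intros z Hz; rewrite (GE _ (Hcube z Hz)); apply has_sum_psum.
  refine (has_sum_ext _ _ _ _ (has_sum_sparse _ _ (psum_correct _ _ HGs (Hcube z Hz)))).
  intros n; unfold P, p; destruct (Nat.eqb_spec (n mod 3) 0) as [E|_]; [|ring].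
  f_equal; replace (z * z * z) with (z ^ 3) by ring; rewrite <- Cpow_mult_r; f_equal.
  generalize (Nat.div_mod_eq n 3); lia.
assert (PQ : forall z, in_disk z -> psum P z = 1 + z * psum Q z).
  intros z Hz; rewrite (psum_split P z HP Hz); unfold P at 1, p at 1; simpl.
  now rewrite G0.
assert (XY : forall z, in_disk z -> psum X z * psum Y z = 1).
  intros z Hz.
  rewrite (constant_on_disk (fun z => psum X z * psum Y z)); auto.
    rewrite !psum_0 by auto; unfold X, Y; rewrite x0, y0; ring.
  intros t Ht; generalize (psum_mult_derive X Y t Hx Hy Ht).
  rewrite xE, yE by auto.
  replace (psum (fun n => RtoC (- q n)) t) with (- psum Q t).
    now replace (psum X t * psum Q t * psum Y t + psum X t * (psum Y t * - psum Q t))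
      with (RtoC 0) by ring.
  symmetry; apply has_sum_psum; generalize (has_sum_scal (-1) _ _ (psum_correct Q t HQ Ht)).
  replace (-1 * psum Q t) with (- psum Q t) by ring.
  apply has_sum_ext; intros n; unfold Q; rewrite RtoC_opp; ring.
assert (XN : forall z, in_disk z -> psum X z <> 0).
  intros z Hz E; generalize (XY z Hz); rewrite E, Cmult_0_l; intros F; injection F; lra.
set (a := shiftseq X).
assert (Ha : disk_seq a) by now apply disk_seq_shiftseq.
assert (Hf := psum_expansion a Ha).
assert (Ef : forall z, in_disk z -> psum a z = z * psum X z).
  intros z Hz; now apply psum_shiftseq.
assert (Ef' : forall z, in_disk z -> psum (dseq a) z = psum X z * psum P z).
  intros z Hz.
  replace (psum X z * psum P z) with (psum X z + z * psum (dseq X) z)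
    by (rewrite PQ, xE by auto; ring).
  assert (HdX := disk_seq_dseq X Hx).
  rewrite <- (psum_shiftseq (dseq X)) by auto.
  apply has_sum_psum; generalize (has_sum_plus _ _ _ _ (psum_correct X z Hx Hz)
    (psum_correct _ z (disk_seq_shiftseq _ HdX) Hz)).
  apply has_sum_ext; intros [|n]; unfold dseq, a, shiftseq; [simpl; ring|].
  rewrite (S_INR (S n)), RtoC_plus; ring.
assert (a1 : a 1%nat = 1) by (unfold a, shiftseq, X; now rewrite x0).
exists (psum a), a; split; [split; [split; [|split]|split]|split].
- intros z Hz; eexists; now apply psum_derive.
- now rewrite psum_0.
- rewrite (C_derive_expansion _ a 0 Hf in_disk_0), psum_0 by now apply disk_seq_dseq.
  unfold dseq; rewrite a1; simpl; ring.
- intros z Hz N; rewrite Ef by auto; apply Cmult_neq_0; auto.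
- exists (fun z => z * z * z); split; [|split; [ring | split; [exact Hcube|]]].
    intros z _; apply smooth_ex_derive; repeat apply smooth_mult; apply smooth_id.
  intros z Hz; rewrite <- PE by auto; unfold starlike_quotient.
  destruct (Ceq_dec z 0) as [->|N].
    rewrite psum_0 by auto; unfold P, p; simpl; now rewrite G0.
  rewrite (C_derive_expansion _ a z Hf Hz), Ef', Ef by auto.
  field; auto.
- exact Hf.
(* The first nonzero coefficient of [Q] is [q 2 = G 1 = 1/2], so [3 * x 3 = 1/2] and
   [a 4 = x 3 = 1/6], while [a 2] and [a 3] vanish. *)
- assert (x1 : x 1%nat = 0%R) by (rewrite xrec, sum_O; unfold q, p; simpl; ring).
  assert (x2 : x 2%nat = 0%R).
    rewrite xrec, sum_Sn, sum_O; unfold q, p, plus; simpl; ring.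
  assert (x3 : x 3%nat = (1 / 6)%R).
    rewrite xrec, !sum_Sn, sum_O; unfold q, p, plus; simpl; rewrite x0, G1; field.
  unfold a, shiftseq, X; rewrite x1, x2, x3.
  replace (RtoC 0 * RtoC 0 - RtoC (1 / 6)) with (- RtoC (1 / 6)) by ring.
  rewrite Cmod_opp, Cmod_R, Rabs_right; lra.
Qed.

Theorem theorem4p2 :
  (forall (f : C -> C) (a : nat -> C),
     class_SG f -> power_expansion f a ->
     (Cmod (a 2%nat * a 3%nat - a 4%nat) <= 1 / 6)%R) /\
  (exists (f : C -> C) (a : nat -> C),
     class_SG f /\ power_expansion f a /\
     Cmod (a 2%nat * a 3%nat - a 4%nat) = (1 / 6)%R).
Proof. exact (conj upper_bound extremal_function). Qed.
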